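(* Let $V_1$ and $V_2$ be two spaces of binary forms, and let $\mathrm{A}=\{\mathbf{f}_1,\dots,\mathbf{f}_p\}\subset\mathbf{Cov}(V_1)$ and $\mathrm{B}=\{\mathbf{g}_1,\dots,\mathbf{g}_q\}\subset\mathbf{Cov}(V_2)$ be finite families of homogeneous covariants generating the algebras $\mathbf{Cov}(V_1)$ and $\mathbf{Cov}(V_2)$ respectively. Let $a_i$ be the order of $\mathbf{f}_i$ and $b_j$ the order of $\mathbf{g}_j$, and consider the linear Diophantine system $$S(\mathrm{A},\mathrm{B}):\quad \begin{cases} a_1\alpha_1+\dots+a_p\alpha_p=u+r,\\ b_1\beta_1+\dots+b_q\beta_q=v+r,\end{cases}$$ with non-negative integer unknowns $(\boldsymbol{\alpha},\boldsymbol{\beta},u,v,r)$. To a solution associate the transvectant $(\mathbf{U},\mathbf{V})_r$ with $\mathbf{U}=\mathbf{f}_1^{\alpha_1}\cdots\mathbf{f}_p^{\alpha_p}$ and $\mathbf{V}=\mathbf{g}_1^{\beta_1}\cdots\mathbf{g}_q^{\beta_q}$. Then the algebra $\mathbf{Cov}(V_1\oplus V_2)$ is generated by the finite family $\mathrm{C}$ of transvectants $(\mathbf{U},\mathbf{V})_r$ corresponding to the irreducible solutions of $S(\mathrm{A},\mathrm{B})$.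
   Context: $\mathrm{S}_n$ is the complex vector space of binary forms of degree $n$ in $\mathbf{x}=(x,y)$, with $\mathrm{SL}_2(\mathbb{C})$ acting by $(g\cdot \mathbf{f})(\mathbf{x})=\mathbf{f}(g^{-1}\cdot\mathbf{x})$. A space of binary forms is a finite direct sum $V=\mathrm{S}_{n_1}\oplus\dots\oplus \mathrm{S}_{n_s}$, and $\mathbf{Cov}(V)=\mathbb{C}[V\oplus\mathbb{C}^2]^{\mathrm{SL}_2(\mathbb{C})}$, bigraded by degree (in the coefficients of $V$) and order (degree in $\mathbf{x}$); homogeneous means bihomogeneous. $\mathbf{Cov}(V_i)$ is viewed inside $\mathbf{Cov}(V_1\oplus V_2)$. Transvectants: with $\Omega_{\alpha\beta}=\frac{\partial}{\partial x_\alpha}\frac{\partial}{\partial y_\beta}-\frac{\partial}{\partial y_\alpha}\frac{\partial}{\partial x_\beta}$ and $\sigma_\alpha=x\frac{\partial}{\partial x_\alpha}+y\frac{\partial}{\partial y_\alpha}$, for covariants $\mathbf{P},\mathbf{Q}$ of orders $m,l$ (regarded as forms of degrees $m,l$ in $\mathbf{x}$), $(\mathbf{P},\mathbf{Q})_r=\Omega_{\alpha\beta}^r\sigma_\alpha^{m-r}\sigma_\beta^{l-r}(\mathbf{P}(\mathbf{x}_\alpha)\mathbf{Q}(\mathbf{x}_\beta))$ if $0\le r\le\min(m,l)$ and $0$ otherwise. A solution of the Diophantine system is irreducible if it is nonzero and is not the sum of two nonzero non-negative integer solutions; there are finitely many irreducible solutions. *)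

(* Defs.v *)
From HB Require Import structures.
From mathcomp Require Import all_boot all_order all_algebra.
From mathcomp Require Import reals mpoly complex.

Set Implicit Arguments.
Unset Strict Implicit.
Unset Printing Implicit Defensive.

Import GRing.Theory.
Local Open Scope ring_scope.

(* The space S_{n_1} (+) ... (+) S_{n_s} is given by the list [n_1; ...; n_s].
   A point of it is the concatenation of the coefficient vectors of its
   components, (c_0, ..., c_n) being the vector of the binary form
   \sum_k c_k x^(n-k) y^k of degree n. *)
Definition binary_space := seq nat.

Fixpoint dim (V : binary_space) : nat := if V is n :: W then (n.+1 + dim W)%N else 0%N.

Lemma dim_cat (V W : binary_space) : (dim V + dim W)%N = dim (V ++ W).
Proof. by elim: V => [|n V IHV] //=; rewrite -addnA IHV. Qed.

Definition bmon (n k : nat) : 'X_{1..2} :=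
  (U_(0%R : 'I_2) *+ (n - k) + U_(1%R : 'I_2) *+ k)%MM.

Definition bform (K : fieldType) (n : nat) (c : 'I_n.+1 -> K) : {mpoly K[2]} :=
  \sum_(k < n.+1) c k *: 'X_[bmon n k].

(* (g . f)(x) = f (g^-1 x), on coefficient vectors *)
Definition bform_act (K : fieldType) (n : nat) (g : 'M[K]_2)
    (c : 'I_n.+1 -> K) : 'I_n.+1 -> K := fun k =>
  (bform c \mPo [tuple \sum_(j < 2) invmx g i j *: 'X_j | i < 2])@_(bmon n k).

Fixpoint space_act (K : fieldType) (V : binary_space) (g : 'M[K]_2) :
    ('I_(dim V) -> K) -> 'I_(dim V) -> K :=
  if V is n :: W then fun v i =>
    match split i with
    | inl k => bform_act g (fun j : 'I_n.+1 => v (lshift (dim W) j)) k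
    | inr k => space_act g (fun j : 'I_(dim W) => v (rshift n.+1 j)) k
    end
  else fun v => v.

Definition plane_act (K : fieldType) (g : 'M[K]_2) (x : 'I_2 -> K) : 'I_2 -> K :=
  fun i => \sum_(j < 2) g i j * x j.

Definition pair_fun (T : Type) (m n : nat) (v : 'I_m -> T) (x : 'I_n -> T) :
    'I_(m + n) -> T :=
  fun i => match split i with inl j => v j | inr k => x k end.

(* C[V (+) C^2]; the last two variables are x and y *)
Notation coord_ring K V := {mpoly K[dim V + 2]}.

Definition Cov (K : fieldType) (V : binary_space) (P : coord_ring K V) : Prop :=
  forall (g : 'M[K]_2) (v : 'I_(dim V) -> K) (x : 'I_2 -> K), \det g = 1 ->
    P.@[pair_fun (space_act g v) (plane_act g x)] = P.@[pair_fun v x].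

Definition bihomogeneous (K : fieldType) (V : binary_space) (degree order : nat)
    (P : coord_ring K V) : Prop :=
  forall mu : 'X_{1..dim V + 2}, mu \in msupp P ->
    (\sum_(i < dim V) mu (lshift 2 i))%N = degree /\
    (\sum_(i < 2) mu (rshift (dim V) i))%N = order.

Definition generates (K : fieldType) (n k : nat) (A : {mpoly K[n]} -> Prop)
    (G : k.-tuple {mpoly K[n]}) : Prop :=
  forall h : {mpoly K[n]}, A h <-> exists P : {mpoly K[k]}, h = P \mPo G.

(* The inclusions of C[V (+) C^2] and C[W (+) C^2] in C[V (+) W (+) C^2] *)
Definition inclL (K : fieldType) (V W : binary_space) (P : coord_ring K V) :
    coord_ring K (V ++ W) :=
  P \mPo [tuple pair_fun
            (fun j => 'X_(lshift 2 (cast_ord (dim_cat V W) (lshift (dim W) j))))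
            (fun k => 'X_(rshift (dim (V ++ W)) k)) i | i < dim V + 2].

Definition inclR (K : fieldType) (V W : binary_space) (P : coord_ring K W) :
    coord_ring K (V ++ W) :=
  P \mPo [tuple pair_fun
            (fun j => 'X_(lshift 2 (cast_ord (dim_cat V W) (rshift (dim V) j))))
            (fun k => 'X_(rshift (dim (V ++ W)) k)) i | i < dim W + 2].

(* C[V (+) C^2][x_alpha, y_alpha, x_beta, y_beta], the ring in which
   transvectants are computed *)
Notation symb_ring K V := {mpoly (coord_ring K V)[2 + 2]}.

Definition xa : 'I_(2 + 2) := lshift 2 0.
Definition ya : 'I_(2 + 2) := lshift 2 1.
Definition xb : 'I_(2 + 2) := rshift 2 0.
Definition yb : 'I_(2 + 2) := rshift 2 1.

(* P(x_alpha) for z = @lshift 2 2, P(x_beta) for z = @rshift 2 2 *)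
Definition put (K : fieldType) (V : binary_space) (z : 'I_2 -> 'I_(2 + 2))
    (P : coord_ring K V) : symb_ring K V :=
  mmap (fun c : K => c%:MP%:MP)
    (pair_fun (fun j => ('X_(lshift 2 j))%:MP) (fun k => 'X_(z k))) P.

Definition Omega (K : fieldType) (V : binary_space) (F : symb_ring K V) : symb_ring K V :=
  F^`M(yb)^`M(xa) - F^`M(xb)^`M(ya).

(* sigma xa ya is sigma_alpha, sigma xb yb is sigma_beta *)
Definition sigma (K : fieldType) (V : binary_space) (i j : 'I_(2 + 2))
    (F : symb_ring K V) : symb_ring K V :=
  ('X_(rshift (dim V) 0))%:MP * F^`M(i) + ('X_(rshift (dim V) 1))%:MP * F^`M(j).

(* (P, Q)_r for P, Q of orders m, l. No symbolic variable is left once the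
   operators have been applied, and the result is the constant coefficient. *)
Definition transvectant (K : fieldType) (V : binary_space) (m l r : nat)
    (P Q : coord_ring K V) : coord_ring K V :=
  if (r <= minn m l)%N then
    (iter r (@Omega K V)
      (iter (m - r) (sigma xa ya)
        (iter (l - r) (sigma xb yb)
          (put (@lshift 2 2) P * put (@rshift 2 2) Q))))@_0%MM
  else 0.

(* The unknowns (alpha, beta, u, v, r), with componentwise 0 and + *)
Notation unknowns p q :=
  ({ffun 'I_p -> nat} * {ffun 'I_q -> nat} * nat * nat * nat)%type.

Definition solution (p q : nat) (a : 'I_p -> nat) (b : 'I_q -> nat)
    (s : unknowns p q) : Prop :=
  let: (alpha, beta, u, v, r) := s in
  (\sum_(i < p) a i * alpha i)%N = (u + r)%N /\
  (\sum_(j < q) b j * beta j)%N = (v + r)%N.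

Definition irreducible_solution (p q : nat) (a : 'I_p -> nat) (b : 'I_q -> nat)
    (s : unknowns p q) : Prop :=
  [/\ solution a b s, s <> 0 &
    ~ exists s1 s2 : unknowns p q,
        [/\ solution a b s1, solution a b s2, s1 <> 0, s2 <> 0 & s = s1 + s2]].

Definition solution_transvectant (K : fieldType) (V1 V2 : binary_space) (p q : nat)
    (a : 'I_p -> nat) (b : 'I_q -> nat)
    (f : p.-tuple (coord_ring K V1)) (g : q.-tuple (coord_ring K V2))
    (s : unknowns p q) : coord_ring K (V1 ++ V2) :=
  let: (alpha, beta, u, v, r) := s in
  transvectant (\sum_(i < p) a i * alpha i)%N (\sum_(j < q) b j * beta j)%N r
    (inclL V2 (\prod_(i < p) tnth f i ^+ alpha i))
    (inclR V1 (\prod_(j < q) tnth g j ^+ beta j)).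

(* Main.v *)
(* A covariant P of V is determined by its leading coefficient z(v) = P(v, (1,0)), which
   is invariant under u_t = [1 t; 0 1]; for V = V1 + V2 this is invariance under u_t acting
   diagonally. Let u_t act on V1 only. Then z(u_t v1, v2) is a polynomial in t, and the
   coefficient w(v1, v2) of its highest power t^r is u_t-invariant in v1 and in v2
   separately, so that w is a linear combination of products U V of leading coefficients of
   monomials in A and in B, where only orders >= r occur. The leading coefficient of
   (U, V)_r also has degree r in t, with top coefficient a nonzero multiple of U V. So
   subtracting transvectants lowers r, and by induction Cov(V1 + V2) is spanned by the
   (U, V)_r. For a sum s1 + s2 of solutions, the transvectant of s1 + s2 and a suitable
   multiple of the product of those of s1 and s2 have the same top coefficient, so by the
   same induction only irreducible solutions are needed. *)

From mathcomp Require Import all_boot all_order all_algebra.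
From mathcomp Require Import boolp reals mpoly complex ring zify.
Require Import Defs.

Set Implicit Arguments.
Unset Strict Implicit.
Unset Printing Implicit Defensive.

Import GRing.Theory.
Local Open Scope ring_scope.

(** The bound on orders is the point where complete reducibility would normally be invoked. Here it
    is replaced by polynomial identities in one group parameter, compared coefficient by
    coefficient; this is why functions are tracked as members of generated algebras. The central
    identity is the factorization of u_t l_{-1/t} through the Weyl element: it bounds the exponents
    of t from above on one side and from below on the other. It yields both the order bound and the
    degree bound that makes a unipotent-invariant weight function the leading coefficient of a
    covariant. The order bound is needed in V1 and in V2. Invariance gives z(v1, u_t v2) = z(u_{-t}
    v1, v2), so the top coefficient of the flow on V2 is (-1)^r w, and the same one-space argument
    serves twice. Passing from slices of w to products takes a rank argument: w is at the outset
    only a finite sum of tensors of arbitrary functions, to be rewritten with factors in the two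
    spans. *)

Lemma mpoly_alg_ind (n : nat) (R : comNzRingType) (S : {mpoly R[n]} -> Prop) :
  (forall c, S c%:MP) -> (forall i, S 'X_i) ->
  (forall p q, S p -> S q -> S (p + q)) -> (forall p q, S p -> S q -> S (p * q)) ->
  forall p, S p.
Proof.
move=> SC SX SD SM; elim/mpolyind => [|c m p _ _ Sp]; first by rewrite -mpolyC0.
apply/SD => //; rewrite -mul_mpolyC; apply/SM => //.
rewrite mpolyXE_id; elim/big_rec: _ => [|i q _ Sq]; first by rewrite -mpolyC1.
by apply/SM => //; elim: (m i) => [|k IH]; rewrite ?expr0 -?mpolyC1 ?exprS //; apply/SM.
Qed.

(** * Polynomial functions *)

Section ZeroLemma.
Variable K : numFieldType.

(** The sample points 1, ..., n are distinct and nonzero in characteristic zero. Excluding [t = 0]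
    allows the use of identities that involve [t^-1]. *)
Lemma poly_eval_eq (p q : {poly K}) :
  (forall t, t != 0 -> p.[t] = q.[t]) -> p = q.
Proof.
move=> pq; apply/eqP; rewrite -subr_eq0; apply/eqP.
pose s := [seq (i.+1)%:R : K | i <- iota 0 (size (p - q))].
apply: (@roots_geq_poly_eq0 _ _ s).
- apply/allP => x /mapP[i _ ->]; rewrite /root hornerD hornerN pq ?subrr //.
  by rewrite Num.Theory.pnatr_eq0.
- rewrite map_inj_uniq ?iota_uniq // => i j /eqP.
  by rewrite Num.Theory.eqr_nat eqSS => /eqP.
- by rewrite size_map size_iota.
Qed.

(** All iterated partial derivatives of a vanishing function vanish, and their values at the origin
    are the coefficients times factorials, which are nonzero in characteristic zero. *)
Lemma meval_eq0 (n : nat) (P : {mpoly K[n]}) : (forall v, P.@[v] = 0) -> P = 0.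
Proof.
move=> P0; have derE i : forall Q : {mpoly K[n]}, (forall v, Q.@[v] = 0) ->
    forall v, (Q^`M(i)).@[v] = 0.
  (* [mmap polyC h] restricts a polynomial to the line through [v] in direction [i]; the derivative
     of the restriction at 0 is the partial derivative at [v]. *)
  move=> Q Q0 v; pose h j : {poly K} := (v j)%:P + (i == j)%:R *: 'X.
  have ev t (U : {mpoly K[n]}) :
      (mmap polyC h U).[t] = U.@[fun j => v j + (i == j)%:R * t].
    elim/mpoly_alg_ind: U => [c|j|U W|U W].
    - by rewrite mmapC mevalC hornerC.
    - by rewrite mmapX mmap1U mevalXU hornerD hornerZ hornerC hornerX.
    - by rewrite rmorphD hornerD mevalD => -> ->.
    - by rewrite rmorphM hornerM mevalM => -> ->.
  have dE (U : {mpoly K[n]}) : (mmap polyC h U)^`() = mmap polyC h (U^`M(i)).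
    elim/mpoly_alg_ind: U => [c|j|U W|U W].
    - by rewrite mmapC derivC mderivC rmorph0.
    - rewrite mmapX mmap1U derivD derivC add0r derivZ derivX mderivX mnm1E.
      rewrite eq_sym; case: eqP => [->|_]; rewrite ?scale0r ?rmorph0 //.
      by rewrite scale1r -[X in (X - _)%MM]add0m addmK mpolyX0 scale1r rmorph1.
    - by rewrite rmorphD derivD mderivD rmorphD => -> ->.
    - by rewrite rmorphM derivM mderivM rmorphD !rmorphM => -> ->.
  have q0 : mmap polyC h Q = 0.
    by apply: poly_eval_eq => t _; rewrite ev Q0 horner0.
  have := ev 0 (Q^`M(i)); rewrite -dE q0 derivC horner0 => ->.
  by apply: meval_eq => j; rewrite mulr0 addr0.
have mP0 m : forall v, (P^`M[m]).@[v] = 0.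
  rewrite mderivm_foldr; elim: flatten => //= i s IH; exact: derE.
apply/mpolyP => m; rewrite mcoeff0; have := mP0 m (fun=> 0).
rewrite (_ : meval _ _ = (P^`M[m])@_0).
  rewrite mcoeff_mderivm addm0 => /eqP; rewrite Num.Theory.mulrn_eq0.
  case/orP => [|/eqP //]; rewrite -leqn0 leqNgt prodn_gt0 // => i.
  by rewrite ffact_gt0.
elim/mpolyind: (P^`M[m]) => [|c k p _ _ IH]; first by rewrite meval0 mcoeff0.
rewrite mevalD mevalZ mevalX mcoeffD mcoeffZ mcoeffX IH; congr (_ * _ + _).
have [->|/eqP k0] := eqVneq k 0%MM.
  by rewrite big1 // => i _; rewrite mnm0E expr0.
have [i ki] : exists i, k i != 0%N.
  apply: contrapT => nk; case: k0; apply/mnmP => i; rewrite mnm0E.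
  by apply/eqP/negP => /negP ki; case: nk; exists i.
by rewrite (bigD1 i) //= expr0n (negbTE ki) mul0r.
Qed.

Lemma meval_inj (n : nat) (P Q : {mpoly K[n]}) : (forall v, P.@[v] = Q.@[v]) -> P = Q.
Proof.
move=> PQ; apply/eqP; rewrite -subr_eq0; apply/eqP/meval_eq0 => v.
by rewrite mevalB PQ subrr.
Qed.

End ZeroLemma.

(** * Algebras generated by functions, and expansions in one parameter *)

Section FunctionAlgebras.
Variable K : fieldType.
Implicit Types T I : Type.

Definition subalg T (S : (T -> K) -> Prop) : Prop :=
  [/\ forall c, S (fun=> c), forall F G, S F -> S G -> S (fun x => F x + G x)
    & forall F G, S F -> S G -> S (fun x => F x * G x)].

(** The subalgebra generated by [E], as the intersection of all subalgebras containing it: a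
    property stable under the algebra operations is proved for its members by taking it as [S]. For
    [E := @coord K n] these are the polynomial functions. *)
Variant palg T I (E : I -> T -> K) (F : T -> K) : Prop :=
  Palg of forall S, subalg S -> (forall i, S (E i)) -> S F.

Definition coord (n : nat) (i : 'I_n) (v : 'I_n -> K) : K := v i.

Definition coord2 (m n : nat) (i : 'I_m + 'I_n) (v : ('I_m -> K) * ('I_n -> K)) : K :=
  match i with inl j => v.1 j | inr j => v.2 j end.

Lemma palg_subalg T I (E : I -> T -> K) : subalg (palg E).
Proof.
split=> [c|F G [PF] [PG]|F G [PF] [PG]]; split=> S sS SE; have [SC SD SM] := sS.
- exact: SC.
- by apply: SD; [apply: PF|apply: PG].
- by apply: SM; [apply: PF|apply: PG].
Qed.

Lemma palg_gen T I (E : I -> T -> K) i : palg E (E i).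
Proof. by split=> S _; apply. Qed.

Lemma palg_comp T T' I I' (E : I -> T -> K) (E' : I' -> T' -> K) (h : T' -> T) F :
  (forall i, palg E' (fun x => E i (h x))) -> palg E F -> palg E' (fun x => F (h x)).
Proof.
move=> Eh [PF]; apply: (PF (fun F => palg E' (fun x => F (h x)))); last exact: Eh.
by have [PC PD PM] := palg_subalg E'; split=> *; [exact: PC|exact: PD|exact: PM].
Qed.

Section Closure.
Variables (T : Type) (S : (T -> K) -> Prop).
Hypothesis sS : subalg S.

Lemma subalg_cst c : S (fun=> c). Proof. by case: sS. Qed.

Lemma subalg_add F G : S F -> S G -> S (fun x => F x + G x). Proof. by case: sS => _ + _; apply. Qed.

Lemma subalg_mul F G : S F -> S G -> S (fun x => F x * G x). Proof. by case: sS => _ _; apply. Qed.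

Lemma subalg_sum (I : Type) (r : seq I) (P : pred I) (F : I -> T -> K) :
  (forall i, P i -> S (F i)) -> S (fun x => \sum_(i <- r | P i) F i x).
Proof.
move=> SF; elim: r => [|i r IH].
  by rewrite (_ : (fun _ => _) = fun=> 0); [apply: subalg_cst|apply/funext => x; rewrite big_nil].
have [Pi|nPi] := boolP (P i).
  rewrite (_ : (fun _ => _) = fun x => F i x + \sum_(i <- r | P i) F i x).
    by apply: subalg_add => //; apply: SF.
  by apply/funext => x; rewrite big_cons Pi.
by rewrite (_ : (fun _ => _) = fun x => \sum_(i <- r | P i) F i x) //;
  apply/funext => x; rewrite big_cons (negbTE nPi).
Qed.

Lemma subalg_exp F k : S F -> S (fun x => F x ^+ k).
Proof.
move=> SF; elim: k => [|k IH]; first exact: subalg_cst.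
rewrite (_ : (fun _ => _) = fun x => F x * F x ^+ k); first exact: subalg_mul.
by apply/funext => x; rewrite exprS.
Qed.

Lemma subalg_scale c F : S F -> S (fun x => c * F x).
Proof. by move=> SF; apply: subalg_mul => //; apply: subalg_cst. Qed.

Lemma subalg_sub F G : S F -> S G -> S (fun x => F x - G x).
Proof.
move=> SF SG; rewrite (_ : (fun _ => _) = fun x => F x + (-1) * G x).
  by apply: subalg_add => //; apply: subalg_scale.
by apply/funext => x; rewrite mulN1r.
Qed.

Lemma subalg_meval n (P : {mpoly K[n]}) (h : T -> 'I_n -> K) :
  (forall i, S (fun x => h x i)) -> S (fun x => P.@[h x]).
Proof.
move=> Sh; elim/mpoly_alg_ind: P => [c|i|P Q SP SQ|P Q SP SQ].
- by rewrite (_ : (fun _ => _) = fun=> c);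
    [apply: subalg_cst|apply/funext => x; rewrite mevalC].
- by rewrite (_ : (fun _ => _) = fun x => h x i) //; apply/funext => x; rewrite mevalXU.
- by rewrite (_ : (fun _ => _) = fun x => P.@[h x] + Q.@[h x]);
    [apply: subalg_add|apply/funext => x; rewrite mevalD].
- by rewrite (_ : (fun _ => _) = fun x => P.@[h x] * Q.@[h x]);
    [apply: subalg_mul|apply/funext => x; rewrite mevalM].
Qed.

(** Families of polynomials with all coefficients in [S]; they serve to follow how [bform_act]
    depends on the group element and on the point. *)
Definition mpoly_in n (F : T -> {mpoly K[n]}) : Prop := forall m, S (fun x => (F x)@_m).

Lemma mpoly_in_cst n (p : {mpoly K[n]}) : mpoly_in (fun=> p).
Proof. by move=> m; apply: subalg_cst. Qed.

Lemma mpoly_in_scale n (c : T -> K) (F : T -> {mpoly K[n]}) :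
  S c -> mpoly_in F -> mpoly_in (fun x => c x *: F x).
Proof.
move=> Sc SF m; rewrite (_ : (fun _ => _) = fun x => c x * (F x)@_m).
  exact: subalg_mul.
by apply/funext => x; rewrite mcoeffZ.
Qed.

Lemma mpoly_in_sum n (I : Type) (r : seq I) (F : I -> T -> {mpoly K[n]}) :
  (forall i, mpoly_in (F i)) -> mpoly_in (fun x => \sum_(i <- r) F i x).
Proof.
move=> SF m; rewrite (_ : (fun _ => _) = fun x => \sum_(i <- r) (F i x)@_m).
  by apply: subalg_sum => i _; apply: SF.
by apply/funext => x; rewrite raddf_sum.
Qed.

Lemma mpoly_in_mul n (F G : T -> {mpoly K[n]}) :
  mpoly_in F -> mpoly_in G -> mpoly_in (fun x => F x * G x).
Proof.
move=> SF SG m; rewrite (_ : (fun _ => _) = fun x =>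
  \sum_(k : 'X_{1..n < (mdeg m).+1, (mdeg m).+1} | m == (k.1 + k.2)%MM) (F x)@_k.1 * (G x)@_k.2).
  by apply: subalg_sum => i _; apply: subalg_mul; [apply: SF|apply: SG].
by apply/funext => x; rewrite mcoeffM.
Qed.

Lemma mpoly_in_exp n (F : T -> {mpoly K[n]}) k :
  mpoly_in F -> mpoly_in (fun x => F x ^+ k).
Proof.
move=> SF; elim: k => [|k IH]; first exact: mpoly_in_cst.
rewrite (_ : (fun _ => _) = fun x => F x * F x ^+ k); first exact: mpoly_in_mul.
by apply/funext => x; rewrite exprS.
Qed.

Lemma mpoly_in_prod n (I : Type) (r : seq I) (F : I -> T -> {mpoly K[n]}) :
  (forall i, mpoly_in (F i)) -> mpoly_in (fun x => \prod_(i <- r) F i x).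
Proof.
move=> SF; elim: r => [|i r IH].
  rewrite (_ : (fun _ => _) = fun=> 1); first exact: mpoly_in_cst.
  by apply/funext => x; rewrite big_nil.
rewrite (_ : (fun _ => _) = fun x => F i x * \prod_(i <- r) F i x).
  exact: mpoly_in_mul.
by apply/funext => x; rewrite big_cons.
Qed.

Lemma subalg_bform_act n (g : T -> 'M[K]_2) (c : T -> 'I_n.+1 -> K) :
  (forall i j, S (fun x => invmx (g x) i j)) -> (forall i, S (fun x => c x i)) ->
  forall k, S (fun x => bform_act (g x) (c x) k).
Proof.
move=> Sg Sc k; rewrite /bform_act; move: (bmon n k).
rewrite -/(mpoly_in (fun x => bform (c x) \mPo [tuple \sum_(j < 2) invmx (g x) i j *: 'X_j | i < 2])).
rewrite (_ : (fun _ => _) = fun x => \sum_(k < n.+1) c x k *: \prod_(i < 2)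
   (\sum_(j < 2) invmx (g x) i j *: 'X_j) ^+ (bmon n k) i); last first.
  apply/funext => x; rewrite /bform raddf_sum /=; apply: eq_bigr => j _.
  rewrite comp_mpolyZ comp_mpolyX; congr (_ *: _).
  by apply: eq_bigr => i _; rewrite tnth_mktuple.
apply: mpoly_in_sum => j; apply: mpoly_in_scale => //.
apply: mpoly_in_prod => i; apply: mpoly_in_exp; apply: mpoly_in_sum => l.
by apply: mpoly_in_scale => //; apply: mpoly_in_cst.
Qed.

Lemma subalg_space_act (V : binary_space) (g : T -> 'M[K]_2) (v : T -> 'I_(dim V) -> K) :
  (forall i j, S (fun x => invmx (g x) i j)) -> (forall i, S (fun x => v x i)) ->
  forall k, S (fun x => space_act (g x) (v x) k).
Proof.
move=> Sg; elim: V v => [|n W IH] v Sv k //=.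
case: split => j; last exact: IH.
exact: subalg_bform_act.
Qed.

End Closure.

Lemma palg_coordP n (F : ('I_n -> K) -> K) :
  palg (@coord n) F -> exists P : {mpoly K[n]}, forall v, F v = P.@[v].
Proof.
case=> PF; apply: (PF (fun F => exists P : {mpoly K[n]}, forall v, F v = P.@[v])); last first.
  by move=> i; exists 'X_i => v; rewrite mevalXU.
split=> [c|F1 F2 [P1 E1] [P2 E2]|F1 F2 [P1 E1] [P2 E2]].
- by exists c%:MP => v; rewrite mevalC.
- by exists (P1 + P2) => v; rewrite mevalD E1 E2.
- by exists (P1 * P2) => v; rewrite mevalM E1 E2.
Qed.

(* With L = true, G (c, x) is a Laurent polynomial in c, only considered for c <> 0;
   with L = false it is a polynomial in c. *)
Definition expands (L : bool) T I (E : I -> T -> K) (G : K * T -> K) : Prop :=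
  exists (M N : nat) (q : T -> {poly K}),
    [/\ ~~ L -> M = 0%N, forall x, (size (q x) <= N)%N, forall i, palg E (fun x => (q x)`_i)
      & forall c x, (L -> c != 0) -> c ^+ M * G (c, x) = (q x).[c]].

Lemma expands_subalg L T I (E : I -> T -> K) : subalg (expands L E).
Proof.
have sE := palg_subalg E; split.
- move=> c; exists 0%N, 1%N, (fun=> c%:P); split=> // [x|i|d x _].
  + exact: size_polyC_leq1.
  + exact: subalg_cst.
  + by rewrite hornerC mul1r.
- move=> F G [M1 [N1 [q1 [M10 S1 P1 E1]]]] [M2 [N2 [q2 [M20 S2 P2 E2]]]].
  (* Both summands are brought to the common denominator [c ^+ (M1 + M2)]; a sum of size bounds is
     enough in place of their maximum. *)
  exists (M1 + M2)%N, (M2 + N1 + (M1 + N2))%N, (fun x => 'X^M2 * q1 x + 'X^M1 * q2 x).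
  have sM M N (q : {poly K}) : (size q <= N)%N -> (size ('X^M * q)%R <= M + N)%N.
    move=> sq; apply: leq_trans (size_polyMleq _ _) _.
    by rewrite size_polyXn addSn /= leq_add2l.
  split=> [nL|x|i|c x cL].
  + by rewrite M10 ?M20.
  + apply: leq_trans (size_polyD _ _) _; rewrite geq_max.
    by rewrite (leq_trans (sM _ _ _ (S1 x))) ?leq_addr // (leq_trans (sM _ _ _ (S2 x))) ?leq_addl.
  + rewrite (_ : (fun _ => _) = fun x => (if (i < M2)%N then 0 else (q1 x)`_(i - M2)) +
      (if (i < M1)%N then 0 else (q2 x)`_(i - M1))).
      apply: subalg_add => //; first by case: (i < M2)%N; [exact: subalg_cst|exact: P1].
      by case: (i < M1)%N; [exact: subalg_cst|exact: P2].
    by apply/funext => x; rewrite coefD !coefXnM.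
  + by rewrite hornerD !hornerM !hornerXn -E1 // -E2 // exprD; ring.
- move=> F G [M1 [N1 [q1 [M10 S1 P1 E1]]]] [M2 [N2 [q2 [M20 S2 P2 E2]]]].
  exists (M1 + M2)%N, (N1 + N2)%N, (fun x => q1 x * q2 x).
  split=> [nL|x|i|c x cL].
  + by rewrite M10 ?M20.
  + apply: leq_trans (size_polyMleq _ _) _.
    by apply: leq_trans (leq_pred _) _; apply: leq_add.
  + rewrite (_ : (fun _ => _) = fun x => \sum_(j < i.+1) (q1 x)`_j * (q2 x)`_(i - j)).
      by apply: subalg_sum => // j _; apply: subalg_mul; [|apply: P1|apply: P2].
    by apply/funext => x; rewrite coefM.
  + by rewrite hornerM -E1 // -E2 // exprD; ring.
Qed.

Lemma expands_gen L T I (E : I -> T -> K) F : palg E F -> expands L E (fun x => F x.2).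
Proof.
move=> PF; exists 0%N, 1%N, (fun x => (F x)%:P); split=> // [x|i|c x _].
- exact: size_polyC_leq1.
- have sE := palg_subalg E; case: i => [|i].
    by rewrite (_ : (fun _ => _) = F) //; apply/funext => x; rewrite coefC.
  by rewrite (_ : (fun _ => _) = fun=> 0); [apply: subalg_cst|apply/funext => x; rewrite coefC].
- by rewrite hornerC mul1r.
Qed.

Lemma expands_par L T I (E : I -> T -> K) : expands L E (fun x => x.1).
Proof.
have sE := palg_subalg E.
exists 0%N, 2%N, (fun=> 'X); split=> // [x|i|c x _]; first by rewrite size_polyX.
  exact: subalg_cst.
by rewrite hornerX mul1r.
Qed.

Lemma expands_inv T I (E : I -> T -> K) : expands true E (fun x => x.1^-1).
Proof.
have sE := palg_subalg E.
exists 1%N, 1%N, (fun=> 1); split=> // [x|i|c x /(_ isT) c0]; first by rewrite size_poly1.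
  exact: subalg_cst.
by rewrite hornerE expr1 mulfV.
Qed.

Lemma expands_comp L T I (E : I -> T -> K) (A : K -> T -> T) F :
  (forall i, expands L E (fun x => E i (A x.1 x.2))) -> palg E F ->
  expands L E (fun x => F (A x.1 x.2)).
Proof.
move=> EA [PF]; apply: (PF (fun F => expands L E (fun x => F (A x.1 x.2)))); last exact: EA.
by have [PC PD PM] := expands_subalg L E; split=> *; [exact: PC|exact: PD|exact: PM].
Qed.

End FunctionAlgebras.

Lemma ord2 (i : 'I_2) : i = 0 \/ i = 1.
Proof. by case: i => -[|[|//]] i2; [left|right]; apply: val_inj. Qed.

Lemma ord2_cases (P : 'I_2 -> Prop) : P 0 -> P 1 -> forall i, P i.
Proof. by move=> P0 P1 i; case: (ord2 i) => ->. Qed.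

Lemma big_ord2 (R : Type) (idx : R) (op : Monoid.law idx) (F : 'I_2 -> R) :
  \big[op/idx]_(i < 2) F i = op (F 0) (F 1).
Proof.
rewrite !big_ord_recl big_ord0 Monoid.mulm1; congr (op (F _) (F _)); exact: val_inj.
Qed.

(** * The action of SL2 *)

Section SL2.
Variable K : fieldType.

Definition vec2 (x y : K) : 'I_2 -> K := fun i => if i == 0 then x else y.

Definition mat2 (a b c d : K) : 'M[K]_2 := \matrix_(i, j) vec2 (vec2 a b j) (vec2 c d j) i.

Lemma vec2_eta (x : 'I_2 -> K) : x = vec2 (x 0) (x 1).
Proof. by apply/funext; apply: ord2_cases. Qed.

Lemma mat2P (g h : 'M[K]_2) :
  g 0 0 = h 0 0 -> g 0 1 = h 0 1 -> g 1 0 = h 1 0 -> g 1 1 = h 1 1 -> g = h.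
Proof.
by move=> *; apply/matrixP; apply: ord2_cases; apply: ord2_cases.
Qed.

Lemma mat2_eta (g : 'M[K]_2) : g = mat2 (g 0 0) (g 0 1) (g 1 0) (g 1 1).
Proof. by rewrite /mat2; apply: mat2P; rewrite !mxE. Qed.

Lemma mat2M a b c d a' b' c' d' : mat2 a b c d *m mat2 a' b' c' d' =
  mat2 (a * a' + b * c') (a * b' + b * d') (c * a' + d * c') (c * b' + d * d').
Proof. by apply: mat2P; rewrite /mat2 !mxE big_ord2 /= !mxE. Qed.

Lemma det_mat2 a b c d : \det (mat2 a b c d) = a * d - b * c.
Proof.
rewrite (expand_det_row _ 0) big_ord2 /= /cofactor !det_mx11 /mat2 !mxE /=.
rewrite /vec2 /= /bump /= expr0 expr1. ring.
Qed.

Lemma det1_unit n (g : 'M[K]_n) : \det g = 1 -> g \in unitmx.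
Proof. by rewrite unitmxE => ->; rewrite unitr1. Qed.

Lemma mat2_1 : mat2 1 0 0 1 = 1%:M.
Proof. by rewrite /mat2; apply: mat2P; rewrite !mxE. Qed.

Lemma invmx_mat2 a b c d : a * d - b * c = 1 -> invmx (mat2 a b c d) = mat2 d (- b) (- c) a.
Proof.
move=> D1; have gU : mat2 a b c d \in unitmx by rewrite det1_unit // det_mat2.
rewrite -[RHS](mulKmx gU) mat2M -[LHS]mulmx1 -mat2_1; congr (_ *m mat2 _ _ _ _);
  rewrite -?D1; ring.
Qed.

Lemma plane_act_mat2 a b c d x y :
  plane_act (mat2 a b c d) (vec2 x y) = vec2 (a * x + b * y) (c * x + d * y).
Proof. by apply/funext; apply: ord2_cases; rewrite /plane_act /mat2 big_ord2 /= !mxE. Qed.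

Lemma plane_actM g h (x : 'I_2 -> K) : plane_act (g *m h) x = plane_act g (plane_act h x).
Proof.
apply/funext => i; rewrite /plane_act !big_ord2 /= !mxE !big_ord2 /=; ring.
Qed.

Lemma plane_act1 (x : 'I_2 -> K) : plane_act 1%:M x = x.
Proof. by apply/funext => i; rewrite /plane_act big_ord2 /= !mxE; case: (ord2 i) => -> /=; ring. Qed.

Lemma pair_fun_l (T : Type) m n (v : 'I_m -> T) (x : 'I_n -> T) i : pair_fun v x (lshift n i) = v i.
Proof. by rewrite /pair_fun (unsplitK (inl i)). Qed.

Lemma pair_fun_r (T : Type) m n (v : 'I_m -> T) (x : 'I_n -> T) i : pair_fun v x (rshift m i) = x i.
Proof. by rewrite /pair_fun (unsplitK (inr i)). Qed.

Lemma bmon0 n k : bmon n k 0 = (n - k)%N.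
Proof. by rewrite /bmon mnmDE !mulmnE !mnm1E /= mul1n mul0n addn0. Qed.

Lemma bmon1 n k : bmon n k 1 = k.
Proof. by rewrite /bmon mnmDE !mulmnE !mnm1E /= mul1n mul0n. Qed.

Lemma mdeg2 (m : 'X_{1..2}) : mdeg m = (m 0%R + m 1%R)%N.
Proof. by rewrite mdegE big_ord2. Qed.

Lemma bmon_mdeg n k : (k <= n)%N -> mdeg (bmon n k) = n.
Proof. by move=> kn; rewrite mdeg2 bmon0 bmon1 subnK. Qed.

Lemma bmonE (m : 'X_{1..2}) : m = bmon (mdeg m) (m 1%R).
Proof.
by apply/mnmP; apply: ord2_cases; rewrite ?bmon0 ?bmon1 // mdeg2 addnK.
Qed.

Lemma mcoeff_bform n (c : 'I_n.+1 -> K) (k : 'I_n.+1) : (bform c)@_(bmon n k) = c k.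
Proof.
rewrite /bform raddf_sum (bigD1 k) //= mcoeffZ mcoeffX eqxx mulr1 big1 ?addr0 // => j jk.
rewrite mcoeffZ mcoeffX; case: eqP => [/(congr1 (fun m : 'X_{1..2} => m 1))|]; rewrite ?mulr0 //.
by rewrite !bmon1 => /val_inj /eqP; rewrite (negbTE jk).
Qed.

Lemma bform_homog n (c : 'I_n.+1 -> K) : bform c \is n.-homog.
Proof.
apply: rpred_sum => k _; apply: rpredZ; rewrite dhomogX; apply/eqP.
by apply: bmon_mdeg; rewrite -ltnS.
Qed.

Lemma homog_bform n (p : {mpoly K[2]}) :
  p \is n.-homog -> p = bform (fun k : 'I_n.+1 => p@_(bmon n k)).
Proof.
move=> hp; apply/mpolyP => m; have [mn|mn] := eqVneq (mdeg m) n; last first.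
  by rewrite !(dhomog_nemf_coeff _ mn) //; apply: bform_homog.
have mlt : (m 1%R < n.+1)%N by rewrite ltnS -mn mdeg2 leq_addl.
by rewrite (bmonE m) mn (mcoeff_bform _ (Ordinal mlt)).
Qed.

Definition lin2 (g : 'M[K]_2) : 2.-tuple {mpoly K[2]} := [tuple \sum_(j < 2) g i j *: 'X_j | i < 2].

Lemma tnth_lin2 g i : tnth (lin2 g) i = g i 0 *: 'X_0 + g i 1 *: 'X_1.
Proof. by rewrite tnth_mktuple big_ord2. Qed.

Lemma mcomp_lin2M g h p : (p \mPo lin2 g) \mPo lin2 h = p \mPo lin2 (g *m h).
Proof.
elim/mpoly_alg_ind: p => [c|i|p q|p q]; rewrite ?comp_mpolyC // ?comp_mpolyD ?rmorphM /= ?rmorphM.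
- rewrite !comp_mpolyXU -!tnth_nth !tnth_lin2 comp_mpolyD !comp_mpolyZ !comp_mpolyXU -!tnth_nth.
  rewrite !tnth_lin2 !scalerDr !scalerA !mxE !big_ord2 /= !scalerDl !addrA.
  by rewrite -!addrA; congr (_ + _); rewrite addrCA.
- by move=> -> ->.
- by move=> -> ->.
Qed.

Lemma mcomp_lin2_homog n g p : p \is n.-homog -> p \mPo lin2 g \is n.-homog.
Proof.
move=> /homog_bform ->; rewrite /bform raddf_sum /=; apply: rpred_sum => k _.
rewrite comp_mpolyZ; apply: rpredZ; rewrite comp_mpolyX big_ord2 /= bmon0 bmon1.
have hl i : tnth (lin2 g) i \is 1.-homog.
  by rewrite tnth_lin2; apply: rpredD; apply: rpredZ; rewrite dhomogX /= mdeg1.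
have := dhomogM (dhomogMn (n - k) (hl 0)) (dhomogMn k (hl 1)).
by rewrite !mul1n subnK // -ltnS.
Qed.

Lemma bform_bform_act n g (c : 'I_n.+1 -> K) : bform (bform_act g c) = bform c \mPo lin2 (invmx g).
Proof. by rewrite [RHS](@homog_bform n) //; apply/mcomp_lin2_homog/bform_homog. Qed.

Lemma invmxM n (g h : 'M[K]_n) : g \in unitmx -> h \in unitmx ->
  invmx (g *m h) = invmx h *m invmx g.
Proof.
move=> gU hU; have ghU : g *m h \in unitmx by rewrite unitmx_mul gU.
rewrite -[RHS](mulKmx ghU) -[g *m h *m (_ *m _)]mulmxA (mulmxA h) (mulmxV hU) mul1mx mulmxV //.
by rewrite mulmx1.
Qed.

Lemma space_actM V g h (v : 'I_(dim V) -> K) : \det g = 1 -> \det h = 1 ->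
  space_act (g *m h) v = space_act g (space_act h v).
Proof.
move=> /det1_unit gU /det1_unit hU; elim: V v => [|n W IH] v //=.
apply/funext => i; case: split => k; last first.
  rewrite IH; congr (space_act g _ k); apply/funext => j.
  by rewrite (unsplitK (inr j)).
rewrite {1}/bform_act invmxM // -/(lin2 _) -mcomp_lin2M -bform_bform_act.
rewrite -/(bform_act g _ k); congr (bform_act g _ k); apply/funext => j.
by rewrite (unsplitK (inl j)).
Qed.

Lemma lin2_1 p : p \mPo lin2 1%:M = p.
Proof.
rewrite -[RHS]comp_mpoly_id; congr (_ \mPo _); apply: eq_from_tnth => i.
by rewrite tnth_lin2 tnth_mktuple !mxE; case: (ord2 i) => ->; rewrite /= scale1r scale0r ?addr0 ?add0r.
Qed.

Lemma space_act1 V (v : 'I_(dim V) -> K) : space_act 1%:M v = v.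
Proof.
elim: V v => [|n W IH] v //=; apply/funext => i.
rewrite -[in RHS](splitK i); case: split => k /=; last by rewrite IH.
by rewrite /bform_act invmx1 lin2_1 mcoeff_bform.
Qed.

(** * Points of a direct sum *)

Section Join.
Variables V1 V2 : binary_space.

Definition join (v1 : 'I_(dim V1) -> K) (v2 : 'I_(dim V2) -> K) : 'I_(dim (V1 ++ V2)) -> K :=
  fun i => pair_fun v1 v2 (cast_ord (esym (dim_cat V1 V2)) i).

(** The indices are related by an equality of naturals, so that later rewriting meets no cast along
    [dim_cat]. *)
Lemma join_l v1 v2 (i : 'I_(dim (V1 ++ V2))) (j : 'I_(dim V1)) : (i = j :> nat) -> join v1 v2 i = v1 j.
Proof.
move=> ij; rewrite /join -[RHS](pair_fun_l v1 v2); congr (pair_fun _ _ _).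
exact: val_inj.
Qed.

Lemma join_r v1 v2 (i : 'I_(dim (V1 ++ V2))) (j : 'I_(dim V2)) : (i = dim V1 + j :> nat)%N -> join v1 v2 i = v2 j.
Proof.
move=> ij; rewrite /join -[RHS](pair_fun_r v1 v2); congr (pair_fun _ _ _).
exact: val_inj.
Qed.

Lemma join_cases (P : 'I_(dim (V1 ++ V2)) -> Prop) :
  (forall (i : 'I_(dim (V1 ++ V2))) (j : 'I_(dim V1)), (i = j :> nat) -> P i) ->
  (forall (i : 'I_(dim (V1 ++ V2))) (j : 'I_(dim V2)), (i = dim V1 + j :> nat)%N -> P i) -> forall i, P i.
Proof.
move=> P1 P2 i; have := splitK (cast_ord (esym (dim_cat V1 V2)) i).
case: split => j /(congr1 val) /= ij; [exact: (P1 _ j)|exact: (P2 _ j)].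
Qed.

Lemma join_eta v : exists v1 v2, v = join v1 v2.
Proof.
exists (fun j => v (cast_ord (dim_cat V1 V2) (lshift _ j))).
exists (fun j => v (cast_ord (dim_cat V1 V2) (rshift _ j))).
apply/funext; apply: join_cases => i j ij.
  by rewrite (join_l _ _ ij); congr v; apply: val_inj.
by rewrite (join_r _ _ ij); congr v; apply: val_inj.
Qed.
End Join.

Lemma space_act_join V1 V2 g (v1 : 'I_(dim V1) -> K) (v2 : 'I_(dim V2) -> K) :
  space_act g (join v1 v2) = join (space_act g v1) (space_act g v2).
Proof.
elim: V1 v1 => [|n W IH] v1.
  have jn (u : 'I_(dim [::]) -> K) w : join u w = w by apply/funext => i; exact: (join_r (V1 := [::])).
  by rewrite !jn.
(* [dim ((n :: W) ++ V2)] unfolds to [n.+1 + dim (W ++ V2)], so the first component can be split off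
   without a cast. *)
have jl (k : 'I_n.+1) u (w : 'I_(dim V2) -> K) :
    join u w (lshift (dim (W ++ V2)) k : 'I_(dim ((n :: W) ++ V2))) = u (lshift (dim W) k : 'I_(dim (n :: W))).
  exact: join_l.
have jr (k : 'I_(dim (W ++ V2))) (u : 'I_(dim (n :: W)) -> K) (w : 'I_(dim V2) -> K) :
    join u w (rshift n.+1 k : 'I_(dim ((n :: W) ++ V2))) = join (fun j => u (rshift n.+1 j)) w k.
  move: k; apply: join_cases => k j kj; [rewrite (join_l _ _ kj)|rewrite (join_r _ _ kj)].
    by apply: join_l => /=; rewrite kj.
  by apply: join_r => /=; rewrite kj addnA.
apply/funext => i; rewrite -(splitK (i : 'I_(n.+1 + dim (W ++ V2)))).
case: split => k; rewrite [unsplit _]/= ?jl ?jr /=.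
  rewrite (unsplitK (inl k)) (unsplitK (inl k)).
  by congr (bform_act g _ k); apply/funext => j; rewrite jl.
rewrite (unsplitK (inr k)).
have -> : (fun j => join v1 v2 (rshift n.+1 j)) = join (fun j => v1 (rshift n.+1 j)) v2.
  by apply/funext => j; rewrite jr.
rewrite IH; congr (join _ _ k); apply/funext => j.
by rewrite (unsplitK (inr j)).
Qed.
End SL2.

Lemma coef_comp_scale (R : comNzRingType) (p : {poly R}) c i : (p \Po (c *: 'X))`_i = c ^+ i * p`_i.
Proof.
rewrite comp_polyE (eq_bigr (fun k : 'I_(size p) => (p`_k * c ^+ k) *: 'X^k)); last first.
  by move=> k _; rewrite exprZn scalerA.
rewrite -(poly_def (size p) (fun k => p`_k * c ^+ k)) coef_poly; case: ltnP => [_|ip].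
  by rewrite mulrC.
by rewrite nth_default // mulr0.
Qed.

(** A shift of the argument affects only coefficients below the degree bound. As u_s shifts the
    parameter of the flow, this gives the unipotent invariance of top coefficients. *)
Lemma coef_comp_shift (R : comNzRingType) (p : {poly R}) c r :
  (size p <= r.+1)%N -> (p \Po ('X + c%:P))`_r = p`_r.
Proof.
move=> sp; have sX k : size (('X + c%:P) ^+ k) = k.+1 by rewrite -[c]opprK polyCN size_exp_XsubC.
rewrite comp_polyE (big_ord_widen _ (fun k => p`_k *: ('X + c%:P) ^+ k) sp) big_mkcond /=.
rewrite (eq_bigr (fun k : 'I_r.+1 => p`_k *: ('X + c%:P) ^+ k)); last first.
  by move=> k _; case: ltnP => // pk; rewrite nth_default // scale0r.
rewrite big_ord_recr /= coefD coef_sum big1 ?add0r => [|k _].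
  rewrite coefZ; have := lead_coefE (('X + c%:P) ^+ r); rewrite sX /= => <-.
  by rewrite (monicP _) ?mulr1 // monic_exp // monicXaddC.
by rewrite coefZ [X in _ * X]nth_default ?mulr0 // sX.
Qed.

Section Rev.
Variable K : fieldType.

(** For [p] of degree at most [B] this is t^B p(-1/t): it clears the denominators when [lun] is
    taken at -1/t. *)
Definition revp (B : nat) (p : {poly K}) : {poly K} :=
  \sum_(n < B.+1) (p`_n * (-1) ^+ n) *: 'X^(B - n).

Lemma coef_revp B (p : {poly K}) n : (n <= B)%N -> (revp B p)`_(B - n) = p`_n * (-1) ^+ n.
Proof.
move=> nB; have nB1 : (n < B.+1)%N by [].
rewrite /revp coef_sum (bigD1 (Ordinal nB1)) //= coefZ coefXn eqxx mulr1 big1 ?addr0 // => k kn.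
rewrite coefZ coefXn; case: eqP; rewrite ?mulr0 // => e; case/eqP: kn; apply: val_inj => /=.
by rewrite -(subKn nB) e subKn // -ltnS.
Qed.

Lemma size_revp B p : (size (revp B p) <= B.+1)%N.
Proof.
apply: (leq_trans (size_sum _ _ _)); apply/bigmax_leqP => n _.
apply: leq_trans (size_scale_leq _ _) _; by rewrite size_polyXn ltnS leq_subr.
Qed.

Lemma horner_revp B (p : {poly K}) (t : K) : (size p <= B.+1)%N -> t != 0 -> (revp B p).[t] = t ^+ B * p.[- t^-1].
Proof.
move=> sp t0; rewrite (horner_coef_wide _ sp) mulr_sumr /revp horner_sum.
apply: eq_bigr => n _; rewrite hornerZ hornerXn expfB_cond; last first.
  by rewrite (negbTE t0) add0n -ltnS.
by rewrite [in RHS]exprNn exprVn; ring.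
Qed.

End Rev.

(** * Leading coefficients of covariants *)

Section OneSpace.
Variables (K : numFieldType) (V : binary_space).
Local Notation X := ('I_(dim V) -> K).
Local Notation palgX := (palg (@coord K (dim V))).
Implicit Types (F G : X -> K).

Definition uni (t : K) := mat2 1 t 0 1.
Definition lun (b : K) := mat2 1 0 b 1.
Definition tor (c : K) := mat2 c 0 0 c^-1.
Definition weyl : 'M[K]_2 := mat2 0 1 (-1) 0.

Lemma det_uni t : \det (uni t) = 1. Proof. by rewrite det_mat2; ring. Qed.
Lemma det_lun t : \det (lun t) = 1. Proof. by rewrite det_mat2; ring. Qed.
Lemma det_weyl : \det weyl = 1. Proof. by rewrite det_mat2; ring. Qed.
Lemma det_tor c : c != 0 -> \det (tor c) = 1. Proof. by move=> c0; rewrite det_mat2; field. Qed.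

Lemma invmx_uni t : invmx (uni t) = uni (- t).
Proof. by rewrite invmx_mat2 /uni; [congr mat2; ring|ring]. Qed.

Lemma invmx_lun t : invmx (lun t) = lun (- t).
Proof. by rewrite invmx_mat2 /uni; [congr mat2; ring|ring]. Qed.

Lemma invmx_tor c : invmx (tor c) = mat2 c^-1 0 0 c.
Proof.
have [->|c0] := eqVneq c 0; last by rewrite invmx_mat2; [congr mat2; ring|field].
(* At [c = 0] both sides are the zero matrix, because [0^-1 = 0] and [invmx] leaves singular
   matrices unchanged. *)
by rewrite /tor invr0 invmx_out // inE unitmxE det_mat2 mulr0 subr0 unitr0.
Qed.

Lemma palg_act F g : palgX F -> palgX (fun v => F (space_act g v)).
Proof.
move=> PF; apply: (@palg_comp _ _ _ _ _ _ _ (@space_act K V g)) PF => i.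
apply: (subalg_space_act (palg_subalg _)) => [j k|k].
  exact: (subalg_cst (palg_subalg _)).
exact: palg_gen.
Qed.

Lemma expands_act L F (g : K -> 'M[K]_2) :
  (forall i j, expands L (@coord K (dim V)) (fun x => invmx (g x.1) i j)) ->
  palgX F -> expands L (@coord K (dim V)) (fun x => F (space_act (g x.1) x.2)).
Proof.
move=> gi PF; apply: (@expands_comp _ _ _ _ _ (fun c => @space_act K V (g c))) PF => i.
apply: (subalg_space_act (expands_subalg L _)) => // k.
exact: (expands_gen L (palg_gen _ _)).
Qed.

Lemma expands_invmx_uni T I (E : I -> T -> K) i j :
  expands false E (fun x => invmx (uni x.1) i j).
Proof.
have sE := expands_subalg false E.
rewrite (_ : (fun _ => _) = fun x => uni ((-1) * x.1) i j); last first.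
  by apply/funext => x; rewrite invmx_uni mulN1r.
rewrite /uni /mat2; case: (ord2 i) => ->; case: (ord2 j) => ->.
- rewrite (_ : (fun _ => _) = fun=> 1); [exact: subalg_cst|by apply/funext => x; rewrite mxE].
- rewrite (_ : (fun _ => _) = fun x => -1 * x.1); last by apply/funext => x; rewrite mxE.
  exact: subalg_scale (expands_par _ _).
- rewrite (_ : (fun _ => _) = fun=> 0); [exact: subalg_cst|by apply/funext => x; rewrite mxE].
- rewrite (_ : (fun _ => _) = fun=> 1); [exact: subalg_cst|by apply/funext => x; rewrite mxE].
Qed.

Lemma uni_expand F : palgX F -> exists N (q : X -> {poly K}),
  [/\ forall v, (size (q v) <= N)%N, forall i, palgX (fun v => (q v)`_i)
    & forall t v, F (space_act (uni t) v) = (q v).[t]].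
Proof.
move=> PF; have := @expands_act false F uni _ PF; case=> [i j|M [N [q [/(_ isT) -> S P E]]]].
  exact: expands_invmx_uni.
by exists N, q; split=> // t v; rewrite -E // mul1r.
Qed.

Lemma lun_expand F : palgX F -> exists N (q : X -> {poly K}),
  [/\ forall v, (size (q v) <= N)%N, forall i, palgX (fun v => (q v)`_i)
    & forall t v, F (space_act (lun t) v) = (q v).[t]].
Proof.
move=> PF; have := @expands_act false F lun _ PF; case=> [i j|M [N [q [/(_ isT) -> S P E]]]].
  have sE := expands_subalg false (@coord K (dim V)).
  rewrite (_ : (fun _ => _) = fun x => lun ((-1) * x.1) i j); last first.
    by apply/funext => x; rewrite invmx_lun mulN1r.
  rewrite /lun /mat2; case: (ord2 i) => ->; case: (ord2 j) => ->.
  - rewrite (_ : (fun _ => _) = fun=> 1); [exact: subalg_cst|by apply/funext => x; rewrite mxE].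
  - rewrite (_ : (fun _ => _) = fun=> 0); [exact: subalg_cst|by apply/funext => x; rewrite mxE].
  - rewrite (_ : (fun _ => _) = fun x => -1 * x.1); last by apply/funext => x; rewrite mxE.
    exact: subalg_scale (expands_par _ _).
  - rewrite (_ : (fun _ => _) = fun=> 1); [exact: subalg_cst|by apply/funext => x; rewrite mxE].
by exists N, q; split=> // t v; rewrite -E // mul1r.
Qed.

Lemma tor_expand F : palgX F -> exists M N (q : X -> {poly K}),
  [/\ forall v, (size (q v) <= N)%N, forall i, palgX (fun v => (q v)`_i)
    & forall c v, c != 0 -> c ^+ M * F (space_act (tor c) v) = (q v).[c]].
Proof.
move=> PF; have := @expands_act true F tor _ PF; case=> [i j|M [N [q [_ S P E]]]].
  have sE := expands_subalg true (@coord K (dim V)).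
  rewrite (_ : (fun _ => _) = fun x => mat2 x.1^-1 0 0 x.1 i j); last first.
    by apply/funext => x; rewrite invmx_tor.
  rewrite /mat2; case: (ord2 i) => ->; case: (ord2 j) => ->.
  - rewrite (_ : (fun _ => _) = fun x => x.1^-1); last by apply/funext => x; rewrite mxE.
    exact: expands_inv.
  - rewrite (_ : (fun _ => _) = fun=> 0); [exact: subalg_cst|by apply/funext => x; rewrite mxE].
  - rewrite (_ : (fun _ => _) = fun=> 0); [exact: subalg_cst|by apply/funext => x; rewrite mxE].
  - rewrite (_ : (fun _ => _) = fun x => x.1); last by apply/funext => x; rewrite mxE.
    exact: expands_par.
by exists M, N, q; split=> // c v c0; rewrite -E.
Qed.

Lemma torM c c' (v : X) : c != 0 -> c' != 0 ->
  space_act (tor c) (space_act (tor c') v) = space_act (tor (c * c')) v.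
Proof.
move=> c0 c'0; rewrite -space_actM ?det_tor // mat2M.
by congr space_act; rewrite /tor; congr mat2; field; rewrite ?c0 ?c'0.
Qed.

Lemma uni_tor t c (v : X) : c != 0 ->
  space_act (tor c) (space_act (uni t) v) = space_act (uni (c ^+ 2 * t)) (space_act (tor c) v).
Proof.
move=> c0; rewrite -!space_actM ?det_tor ?det_uni // !mat2M.
by congr space_act; congr mat2; field.
Qed.

Lemma uniD t s (v : X) : space_act (uni t) (space_act (uni s) v) = space_act (uni (t + s)) v.
Proof.
rewrite -space_actM ?det_uni // mat2M.
by congr space_act; congr mat2; ring.
Qed.

Lemma uni0 (v : X) : space_act (uni 0) v = v.
Proof. by rewrite /uni mat2_1 space_act1. Qed.

(** Torus weight [j - i], an integer kept as a pair of naturals so that only nonnegative powers of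
    [c] occur. Leading coefficients in order [m] have [weight m 0]. *)
Definition weight (i j : nat) F : Prop :=
  forall c v, c != 0 -> c ^+ i * F (space_act (tor c) v) = c ^+ j * F v.

(** The coefficients of F(d_c v) as a Laurent polynomial in c are the weight components of [F]:
    moving v by d_c rescales the variable, and c = 1 recovers [F]. *)
Lemma tor_decomp F : palgX F -> exists M N (q : X -> {poly K}),
  [/\ forall i, palgX (fun v => (q v)`_i), forall i, weight M i (fun v => (q v)`_i),
      forall c v, c != 0 -> c ^+ M * F (space_act (tor c) v) = \sum_(i < N) c ^+ i * (q v)`_i
    & forall v, F v = \sum_(i < N) (q v)`_i].
Proof.
case/tor_expand => M [N [q [S P E]]]; exists M, N, q; split=> // [i c v c0|c v c0|v].
- have : c ^+ M *: q (space_act (tor c) v) = q v \Po (c *: 'X).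
    apply: poly_eval_eq => d d0; rewrite hornerZ -E // torM // horner_comp hornerZ hornerX.
    by rewrite -E ?mulf_neq0 // exprMn (mulrC d c); ring.
  by move/(congr1 (fun p : {poly K} => p`_i)); rewrite coefZ coef_comp_scale.
- by rewrite E // (horner_coef_wide _ (S v)); apply: eq_bigr => i _; rewrite mulrC.
- have := E 1 v (oner_neq0 _); rewrite expr1n mul1r {1}/tor invr1 mat2_1 space_act1 => ->.
  by rewrite (horner_coef_wide _ (S v)); apply: eq_bigr => i _; rewrite expr1n mulr1.
Qed.

(* u_t l_{-1/t} = w d_{1/t} u_{-t}: an expansion in t on the left meets an expansion
   in the opposite direction on the right. *)
Lemma uni_lun t (v : X) : t != 0 -> space_act (uni t) (space_act (lun (- t^-1)) v) =
  space_act (tor t) (space_act weyl (space_act (uni (- t)) v)).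
Proof.
move=> t0; have dw := det_weyl; have dt := det_tor t0.
rewrite -!space_actM ?det_mulmx ?det_uni ?det_lun ?dw ?dt ?mulr1 //.
by rewrite !mat2M; congr space_act; congr mat2; field.
Qed.

(** [F] is evaluated on both sides of [uni_lun]: the left gives powers t^k with k at most r times
    polynomials in -1/t, the right t^(j - i) times a polynomial in t. Multiplying by t^(i + B)
    leaves an identity of polynomials. *)
Lemma bruhat_identity F (q : X -> {poly K}) i j r :
  palgX F -> weight i j F -> (forall k, palgX (fun v => (q v)`_k)) ->
  (forall v, (size (q v) <= r.+1)%N) -> (forall t v, F (space_act (uni t) v) = (q v).[t]) ->
  exists B (p : nat -> X -> {poly K}) (q' : X -> {poly K}),
  [/\ forall k b v, (q (space_act (lun b) v))`_k = (p k v).[b],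
      forall k v, (k <= r)%N -> (size (p k v) <= B.+1)%N,
      forall t v, F (space_act weyl (space_act (uni (- t)) v)) = (q' v).[t]
    & forall v, 'X^i * (\sum_(k < r.+1) 'X^k * revp B (p k v)) = 'X^(j + B) * q' v].
Proof.
move=> PF wF Pq Sq Eq.
have /boolp.choice [Np_p Hp] (k : nat) : exists Np_p : nat * (X -> {poly K}),
    (forall v, (size (Np_p.2 v) <= Np_p.1)%N) /\
    forall t v, (q (space_act (lun t) v))`_k = (Np_p.2 v).[t].
  by have [N [p [S _ E]]] := lun_expand (Pq k); exists (N, p).
pose Np k := (Np_p k).1; pose p k := (Np_p k).2.
have [N' [q' [_ Pq' Eq']]] := uni_expand (palg_act weyl PF).
pose B := (\max_(k < r.+1) Np k)%N.
have SB k v : (k <= r)%N -> (size (p k v) <= B.+1)%N.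
  move=> kr; have kr1 : (k < r.+1)%N by [].
  by apply: leq_trans ((Hp k).1 v) (leqW _); apply: (leq_bigmax (Ordinal kr1)).
exists B, p, (fun v => q' v \Po (-'X)); split=> // [k b v|t v|v].
- exact: (Hp k).2.
- by rewrite Eq' horner_comp hornerN hornerX.
apply: poly_eval_eq => t t0; rewrite !hornerM !hornerXn horner_sum horner_comp hornerN hornerX.
rewrite -Eq' exprD; have := wF t (space_act weyl (space_act (uni (- t)) v)) t0.
rewrite -uni_lun // Eq (horner_coef_wide _ (Sq _)) => e.
rewrite mulrAC -e -mulrA; congr (_ * _); rewrite mulr_suml; apply: eq_bigr => k _.
have kr : (k <= r)%N by rewrite -ltnS.
rewrite hornerM hornerXn (horner_revp (SB k v kr) t0).
rewrite ((Hp k).2 (- t^-1) v) mulrC; set x := horner _ _; move: x (t ^+ k) (t ^+ B) => x y z.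
ring.
Qed.

(** In [bruhat_identity] the degree on the left is at most [i + r + B], while the right is divisible
    by X^(j + B). This is the sl2 fact that a nonzero weight vector killed by the (r+1)-st power of
    the weight-lowering operator has weight at most [r]. *)
Lemma weight_bound F (q : X -> {poly K}) i j r :
  palgX F -> weight i j F -> (forall k, palgX (fun v => (q v)`_k)) ->
  (forall v, (size (q v) <= r.+1)%N) -> (forall t v, F (space_act (uni t) v) = (q v).[t]) ->
  (i + r < j)%N -> forall v, F v = 0.
Proof.
move=> PF wF Pq Sq Eq ij v.
have [B [p [q' [_ Sp Eq' E]]]] := bruhat_identity PF wF Pq Sq Eq.
have q0 w : q' w = 0.
  apply/polyP => n; rewrite coef0.
  have := congr1 (fun p : {poly K} => p`_(j + B + n)) (E w).
  rewrite (_ : ('X^(j + B) * q' w)`_(j + B + n) = (q' w)`_n); last first.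
    by rewrite coefXnM ltnNge leq_addr /= addKn.
  move=> <-; rewrite coefXnM; case: ifP => // _.
  rewrite coef_sum big1 // => k _; rewrite coefXnM; case: ifP => // _.
  rewrite nth_default //; apply: leq_trans (size_revp _ _) _.
  have kr : (k <= r)%N by rewrite -ltnS.
  rewrite -subnDA; apply: leq_trans (_ : (j + B + n - (i + r) <= _)%N); last first.
    by rewrite leq_sub2l // leq_add2l.
  by rewrite leq_subRL; [|]; lia.
(* So far [F] vanishes at w u_{-t} v for all t and v; since w u_{-1} acts invertibly, [t = 1]
   reaches every point. *)
have /det1_unit gU : \det (weyl *m uni (- 1)) = 1 by rewrite det_mulmx det_weyl det_uni mulr1.
have dI : \det (invmx (weyl *m uni (- 1))) = 1.
  by rewrite det_inv det_mulmx det_weyl det_uni mulr1 invr1.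
have := Eq' 1 (space_act (invmx (weyl *m uni (- 1))) v).
by rewrite q0 horner0 -!space_actM ?det_weyl ?det_uni ?mulmxA ?det_mulmx ?det_weyl ?det_uni ?mulr1 // mulmxV // space_act1.
Qed.

End OneSpace.

(** * Linear spans of sets of functions *)

Section LinearSpan.
Variable K : fieldType.

Definition lclosed T (C : (T -> K) -> Prop) : Prop :=
  [/\ C (fun=> 0), forall F G, C F -> C G -> C (fun x => F x + G x)
    & forall c F, C F -> C (fun x => c * F x)].

Variant lspan T (S : (T -> K) -> Prop) (F : T -> K) : Prop :=
  LSpan of forall C, lclosed C -> (forall G, S G -> C G) -> C F.

Lemma lspan_closed T (S : (T -> K) -> Prop) : lclosed (lspan S).
Proof.
split=> [|F G [SF] [SG]|c F [SF]]; split=> C cC SC; have [C0 CD CM] := cC => //.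
  by apply: CD; [exact: SF|exact: SG].
by apply: CM; exact: SF.
Qed.

Lemma lspan_gen T (S : (T -> K) -> Prop) F : S F -> lspan S F.
Proof. by move=> SF; split=> C _; apply. Qed.

Lemma lclosed_sum T (C : (T -> K) -> Prop) (I : eqType) (r : seq I) (P : pred I) (F : I -> T -> K) :
  lclosed C -> (forall i, i \in r -> P i -> C (F i)) -> C (fun x => \sum_(i <- r | P i) F i x).
Proof.
case=> C0 CD _; elim: r => [|i r IH] CF.
  by rewrite (_ : (fun _ => _) = fun=> 0) //; apply/funext => x; rewrite big_nil.
have Cr : C (fun x => \sum_(i <- r | P i) F i x).
  by apply: IH => j jr; apply: CF; rewrite inE jr orbT.
have [Pi|nPi] := boolP (P i); last first.
  by rewrite (_ : (fun _ => _) = fun x => \sum_(i <- r | P i) F i x) //;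
    apply/funext => x; rewrite big_cons (negbTE nPi).
rewrite (_ : (fun _ => _) = fun x => F i x + \sum_(i <- r | P i) F i x).
  by apply: CD => //; apply: CF; rewrite ?mem_head.
by apply/funext => x; rewrite big_cons Pi.
Qed.

End LinearSpan.

(** * From unipotent-invariant weight functions to covariants *)

Section OneSpace.
Variables (K : numFieldType) (V : binary_space).
Local Notation X := ('I_(dim V) -> K).
Local Notation palgX := (palg (@coord K (dim V))).
Implicit Types (F G : X -> K).

(* The value of a covariant at x = (1, 0), which determines it. *)
Definition lead (P : coord_ring K V) (v : X) : K := P.@[pair_fun v (vec2 1 0)].

Lemma lead_uni P t v : Cov P -> lead P (space_act (uni t) v) = lead P v.
Proof.
move=> cP; rewrite /lead -[RHS](cP (uni t)) ?det_uni // plane_act_mat2.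
by congr (_.@[pair_fun _ (vec2 _ _)]); ring.
Qed.

(** The matrix on the right is the inverse of [x0 0; x1 1/x0], which moves (1, 0) to x. The right
    side is thus the only possible value at (v, x) of a covariant with leading coefficient [F], and
    the left side extends it polynomially to x0 = 0. *)
Lemma lift_formula m F (p : X -> {poly K}) (x : 'I_2 -> K) (v : X) :
  (forall t v, F (space_act (lun t) v) = (p v).[t]) -> (forall v, (size (p v) <= m.+1)%N) ->
  weight m 0 F -> x 0 != 0 ->
  \sum_(i < m.+1) x 0 ^+ (m - i) * (- x 1) ^+ i * (p v)`_i =
  F (space_act (mat2 (x 0)^-1 0 (- x 1) (x 0)) v).
Proof.
move=> pE sp wF x0; set y := space_act (lun (- x 1 / x 0)) v.
have -> : space_act (mat2 (x 0)^-1 0 (- x 1) (x 0)) v = space_act (tor (x 0)^-1) y.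
  rewrite /y -space_actM ?det_tor ?det_lun ?invr_eq0 // mat2M.
  by congr space_act; congr mat2; field.
have := wF (x 0)^-1 y; rewrite invr_eq0 x0 mul1r => /(_ isT) => e.
have -> : F (space_act (tor (x 0)^-1) y) = x 0 ^+ m * F y.
  by rewrite -e mulrA -exprMn mulfV // expr1n mul1r.
rewrite pE (horner_coef_wide _ (sp v)) mulr_sumr; apply: eq_bigr => i _.
have im : (i <= m)%N by rewrite -ltnS.
by rewrite expfB_cond ?(negbTE x0) ?add0n // exprMn exprVn; ring.
Qed.

(** The covariant is the polynomial of [lift_formula]. Replacing (v, x) by (g v, g x) changes the
    point at which [F] is evaluated only by a unipotent, and [F] does not see it. *)
Lemma lift_covariant m F : palgX F -> (forall t v, F (space_act (uni t) v) = F v) ->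
  weight m 0 F -> exists2 W : coord_ring K V, Cov W & forall v, lead W v = F v.
Proof.
move=> PF uF wF; have [N [p [_ Pp Ep]]] := lun_expand PF.
have sp v : (size (p v) <= m.+1)%N.
  (* With [r = 0] the identity says that X^B divides X^m times [revp B (q 0 v)], which kills the
     coefficients of [q 0 v] in degrees above [m]. *)
  have [|||B [q [q' [Eq Sq _ E]]]] := @bruhat_identity _ _ F (fun v => (F v)%:P) m 0 0 PF wF.
  - move=> k; have sX := palg_subalg (@coord K (dim V)); case: k => [|k].
      by rewrite (_ : (fun _ => _) = F) //; apply/funext => w; rewrite coefC.
    by rewrite (_ : (fun _ => _) = fun=> 0); [exact: subalg_cst|apply/funext => w; rewrite coefC].
  - by move=> w; apply: size_polyC_leq1.
  - by move=> t w; rewrite hornerC uF.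
  have pq : p v = q 0%N v by apply: poly_eval_eq => t _; rewrite -Ep -Eq coefC.
  apply/leq_sizeP => n mn; rewrite pq.
  have [nB|Bn] := leqP n B; last by rewrite nth_default // (leq_trans (Sq _ _ _)).
  have := congr1 (fun p : {poly K} => p`_(m + (B - n))) (E v).
  rewrite big_ord1 mul1r add0n !coefXnM ltnNge leq_addr /= addKn coef_revp //.
  rewrite (_ : (_ < B)%N); last by rewrite addnBA // ltn_subLR; lia.
  by move/eqP; rewrite mulf_eq0 expf_eq0 oppr_eq0 oner_eq0 andbF orbF => /eqP.
pose Wf (y : 'I_(dim V + 2) -> K) := \sum_(i < m.+1)
  y (rshift _ 0) ^+ (m - i) * (- y (rshift _ 1)) ^+ i * (p (fun j => y (lshift 2 j)))`_i.
have PW : palg (@coord K (dim V + 2)) Wf.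
  have sX := palg_subalg (@coord K (dim V + 2)).
  have gX i : palg (@coord K (dim V + 2)) (fun y => y i) by exact: palg_gen.
  apply: subalg_sum => // i _; apply: subalg_mul => //; first apply: subalg_mul => //.
  - exact: subalg_exp.
  - apply: subalg_exp => //.
    rewrite (_ : (fun _ => _) = fun y => (-1) * y (rshift (dim V) 1)).
      exact: subalg_scale.
    by apply/funext => y; rewrite mulN1r.
  - apply: (@palg_comp _ _ _ _ _ _ _ (fun (y : 'I_(dim V + 2) -> K) j => y (lshift 2 j))) (Pp i).
    by move=> j; exact: gX.
have [W EW] := palg_coordP PW.
have WE v x : W.@[pair_fun v x] =
    \sum_(i < m.+1) x 0 ^+ (m - i) * (- x 1) ^+ i * (p v)`_i.
  rewrite -EW /Wf !pair_fun_r; apply: eq_bigr => i _.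
  by congr (_ * (p _)`_i); apply/funext => j; rewrite pair_fun_l.
exists W => [g v x|v]; last first.
  rewrite /lead WE (lift_formula _ Ep) //= ?oner_eq0 //.
  by rewrite /vec2 /= invr1 oppr0 mat2_1 space_act1.
have [a [b [c [d ->]]]] : exists a b c d, g = mat2 a b c d.
  by exists (g 0 0), (g 0 1), (g 1 0), (g 1 1); apply: mat2_eta.
rewrite det_mat2 => D.
have WE' (y : X) (z : 'I_2 -> K) : z 0 != 0 -> W.@[pair_fun y z] =
    F (space_act (mat2 (z 0)^-1 0 (- z 1) (z 0)) y).
  by move=> z0; rewrite WE (lift_formula _ Ep).
have Pg u : palg (@coord K 2) (fun x => W.@[pair_fun u x]).
  have sX := palg_subalg (@coord K 2).
  apply: (subalg_meval sX) => i; rewrite /pair_fun; case: split => j.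
    exact: subalg_cst.
  exact: palg_gen.
have Pgl i : palg (@coord K 2) (fun x => plane_act (mat2 a b c d) x i).
  have sX := palg_subalg (@coord K 2).
  apply: subalg_sum => // j _; apply: subalg_scale => //; exact: palg_gen.
have [A EA] : exists A : {mpoly K[2]}, forall x,
    W.@[pair_fun (space_act (mat2 a b c d) v) (plane_act (mat2 a b c d) x)] - W.@[pair_fun v x] = A.@[x].
  apply: palg_coordP; apply: subalg_sub => //; first exact: palg_subalg.
  apply: (@palg_comp _ _ _ _ _ _ _ (@plane_act K (mat2 a b c d))) (Pg _) => i.
  exact: Pgl.
suff A0 : A = 0 by apply/eqP; rewrite -subr_eq0 EA A0 meval0.
pose L : {mpoly K[2]} := a *: 'X_0 + b *: 'X_1.
have LE z : L.@[z] = (a * z 0 + b * z 1).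
  by rewrite /L mevalD !mevalZ !mevalXU.
(* [lift_formula] requires nonzero first coordinates of z and of g z. Multiplying by these two
   linear forms makes the identity hold everywhere, and they cancel in a domain. *)
have : A * ('X_0 * L) = 0.
  apply: meval_eq0 => z; rewrite !mevalM mevalXU LE.
  have [->|z0] := eqVneq (z 0) 0; first by rewrite mul0r mulr0.
  have pz : plane_act (mat2 a b c d) z = vec2 (a * z 0 + b * z 1) (c * z 0 + d * z 1).
    by rewrite {1}(vec2_eta z) plane_act_mat2.
  have [->|gz0] := eqVneq (a * z 0 + b * z 1) 0; first by rewrite !mulr0.
  rewrite -EA !WE' ?pz // [X in (X - _) * _](_ : _ = F (space_act (mat2 (z 0)^-1 0 (- z 1) (z 0)) v)).
    by rewrite subrr mul0r.
  (* If h_x denotes the matrix moving (1, 0) to x, then h_{gz}^-1 g h_z fixes (1, 0); it is the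
     unipotent with this parameter. *)
  rewrite -[RHS](uF (b / (z 0 * (a * z 0 + b * z 1)))) -!space_actM ?det_uni //; last first.
  - by rewrite det_mat2.
  - by rewrite det_mat2 /vec2 /=; field.
  - by rewrite det_mat2; field.
  congr (F (space_act _ v)); rewrite !mat2M /vec2 /=.
  have Dd : b * c = a * d - 1 by rewrite -D; ring.
  by congr mat2; field: Dd; rewrite ?z0 ?gz0.
move/eqP; rewrite !mulf_eq0 => /or3P[/eqP //|/eqP X0|/eqP L0].
  have := congr1 (meval (vec2 1 0 : 'I_2 -> K)) X0.
  by rewrite mevalXU meval0 => /eqP; rewrite oner_eq0.
have := congr1 (meval (vec2 1 0 : 'I_2 -> K)) L0.
have := congr1 (meval (vec2 0 1 : 'I_2 -> K)) L0.
rewrite !LE !meval0 /vec2 /= !mulr0 !mulr1 add0r addr0 => b0 a0.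
move: D; rewrite a0 b0 !mul0r subrr => /eqP.
by rewrite eq_sym oner_eq0.
Qed.

End OneSpace.

(** * The binary form obtained by fixing the point of V *)

Section FormAt.
Variables (K : fieldType) (V : binary_space).

Definition form_at (v : 'I_(dim V) -> K) (P : coord_ring K V) : {mpoly K[2]} :=
  mmap (@mpolyC 2 K) (pair_fun (fun j => (v j)%:MP) (fun k => 'X_k)) P.

Lemma meval_form_at v P x : (form_at v P).@[x] = P.@[pair_fun v x].
Proof.
elim/mpoly_alg_ind: P => [c|i|P Q|P Q]; rewrite /form_at.
- by rewrite mmapC !mevalC.
- by rewrite mmapX mmap1U mevalXU /pair_fun; case: split => j; rewrite ?mevalC ?mevalXU.
- by rewrite mmapD !mevalD => -> ->.
- by rewrite rmorphM !mevalM => -> ->.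
Qed.

Lemma form_at_homog v P d e : bihomogeneous d e P -> form_at v P \is e.-homog.
Proof.
move=> hP; rewrite /form_at /mmap big_seq; apply: rpred_sum => m /hP [_ ma].
rewrite mul_mpolyC; apply: rpredZ; rewrite /mmap1 big_split_ord /=.
under eq_bigr do rewrite pair_fun_l -rmorphXn.
rewrite -rmorph_prod mul_mpolyC; apply: rpredZ; rewrite big_ord2 /= !pair_fun_r.
have X1 k : 'X_k \is [in K[2], 1.-homog] by rewrite dhomogX /= mdeg1.
have := dhomogM (dhomogMn (m (rshift (dim V) 0%R)) (X1 0)) (dhomogMn (m (rshift (dim V) 1%R)) (X1 1)).
by rewrite !mul1n -ma big_ord2.
Qed.

Lemma homog_scale d (p : {mpoly K[2]}) s x y : p \is d.-homog ->
  p.@[vec2 (s * x) (s * y)] = s ^+ d * p.@[vec2 x y].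
Proof.
move=> /homog_bform ->; rewrite /bform !raddf_sum mulr_sumr; apply: eq_bigr => k _ /=.
rewrite !mevalZ !mevalX !big_ord2 /= bmon0 bmon1 /vec2 /= !exprMn.
have -> : s ^+ d = s ^+ (d - k) * s ^+ k by rewrite -exprD subnK // -ltnS.
ring.
Qed.

End FormAt.

(** * Spanning by leading coefficients of monomials in the generators *)

Section OneSpace.
Variables (K : numFieldType) (V : binary_space) (p : nat).
Variables (f : p.-tuple (coord_ring K V)) (a : 'I_p -> nat).
Hypothesis hf : forall i : 'I_p, exists d : nat, bihomogeneous d (a i) (tnth f i).
Hypothesis genf : generates (@Cov K V) f.
Local Notation X := ('I_(dim V) -> K).
Local Notation palgX := (palg (@coord K (dim V))).

Definition monom (alpha : 'I_p -> nat) : coord_ring K V := \prod_(i < p) tnth f i ^+ alpha i.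

Definition order (alpha : 'I_p -> nat) : nat := \sum_(i < p) a i * alpha i.

Lemma Cov_gen i : Cov (tnth f i).
Proof. by apply/genf; exists 'X_i; rewrite comp_mpolyXU -tnth_nth. Qed.

Lemma weight_gen i : weight (a i) 0 (lead (tnth f i)).
Proof.
move=> c v c0; rewrite mul1r /lead; have [d hd] := hf i.
have -> : (tnth f i).@[pair_fun (space_act (tor c) v) (vec2 1 0)] = (tnth f i).@[pair_fun v (vec2 c^-1 0)].
  rewrite -[RHS](Cov_gen i _ _ (det_tor c0)) plane_act_mat2.
  by congr (_.@[pair_fun _ (vec2 _ _)]); field.
rewrite -!meval_form_at; have := homog_scale c^-1 1 0 (form_at_homog v hd).
rewrite mulr1 mulr0 => ->; by rewrite mulrA -exprMn mulfV // expr1n mul1r.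
Qed.

Lemma lead_monom alpha v : lead (monom alpha) v = \prod_(i < p) lead (tnth f i) v ^+ alpha i.
Proof. by rewrite /lead rmorph_prod; apply: eq_bigr => i _; rewrite rmorphXn. Qed.

Lemma weight_monom alpha : weight (order alpha) 0 (lead (monom alpha)).
Proof.
move=> c v c0; rewrite mul1r !lead_monom /order.
rewrite expr_sum -big_split; apply: eq_bigr => i _ /=.
by rewrite exprM -exprMn weight_gen // mul1r.
Qed.

Lemma homog_form_monom alpha v : form_at v (monom alpha) \is (order alpha).-homog.
Proof.
rewrite /monom /order /form_at rmorph_prod.
elim/big_rec2: _ => [|i n q _ hq]; first exact: dhomog1.
apply: dhomogM => //; rewrite rmorphXn; have [d hd] := hf i.
by apply: dhomogMn; apply: (form_at_homog v hd).
Qed.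

(** A covariant is a polynomial in the generators; comparing torus weights removes the monomials of
    order other than [m]. Since the weights are negative, everything is multiplied by c^M, with [M]
    above all the orders involved. *)
Lemma lead_weight_span m F : (exists2 W, Cov W & forall v, lead W v = F v) -> weight m 0 F ->
  lspan (fun G => exists2 alpha : {ffun 'I_p -> nat}, order alpha = m & G = lead (monom alpha)) F.
Proof.
move=> [W /genf [P WP] WF] wF.
pose fm (mu : 'X_{1..p}) := [ffun i => mu i].
have FE v : F v = \sum_(mu <- msupp P) P@_mu * lead (monom (fm mu)) v.
  rewrite -WF WP /lead comp_mpoly_meval mevalE; apply: eq_bigr => mu _.
  congr (_ * _); rewrite /monom rmorph_prod; apply: eq_bigr => i _.
  by rewrite rmorphXn ffunE.
pose M := (m + \max_(mu <- msupp P) order (fm mu))%N.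
have leM mu : mu \in msupp P -> (order (fm mu) <= M)%N.
  by move=> muP; rewrite (leq_trans _ (leq_addl _ _)) // (leq_bigmax_seq _ muP).
have FM v : F v = \sum_(mu <- msupp P | order (fm mu) == m) P@_mu * lead (monom (fm mu)) v.
  have : F v *: 'X^(M - m) = \sum_(mu <- msupp P) (P@_mu * lead (monom (fm mu)) v) *: 'X^(M - order (fm mu)).
    apply: poly_eval_eq => c c0; rewrite hornerZ hornerXn horner_sum.
    have := wF c v c0; rewrite mul1r => e1.
    have -> : F v * c ^+ (M - m) = c ^+ M * F (space_act (tor c) v).
      by rewrite -e1 mulrAC -exprD subnKC // leq_addr.
    rewrite FE mulr_sumr !big_seq; apply: eq_bigr => mu muP.
    rewrite hornerZ hornerXn; have := weight_monom (fm mu) v c0; rewrite mul1r => <-.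
    have -> : c ^+ M = c ^+ order (fm mu) * c ^+ (M - order (fm mu)).
      by rewrite -exprD subnKC ?leM.
    set y := lead _ _; move: y P@_mu (c ^+ _) (c ^+ _) => y1 y2 y3 y4; ring.
  move/(congr1 (fun q : {poly K} => q`_(M - m))); rewrite coefZ coefXn eqxx mulr1 => ->.
  rewrite coef_sum [RHS]big_mkcond !big_seq; apply: eq_bigr => mu muP.
  rewrite coefZ coefXn; case: ifPn => [/eqP -> |om]; first by rewrite eqxx mulr1.
  case: eqP => [e|_]; last by rewrite mulr0.
  case/eqP: om; rewrite -(subKn (leM _ muP)) -e subKn //; exact: leq_addr.
have [_ _ cZ] := lspan_closed (fun G => exists2 alpha : {ffun 'I_p -> nat}, order alpha = m & G = lead (monom alpha)).
have -> : F = fun v => \sum_(mu <- msupp P | order (fm mu) == m) P@_mu * lead (monom (fm mu)) v.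
  by apply/funext.
apply: lclosed_sum => [|mu _ /eqP om]; first exact: lspan_closed.
by apply: cZ; apply: lspan_gen; exists (fm mu).
Qed.

(* The top coefficient is unipotent-invariant, hence a sum of leading coefficients of
   covariants; weight_bound says that only orders >= r occur. *)
Lemma top_coef_span F (q : X -> {poly K}) r :
  palgX F -> (forall t v, F (space_act (uni t) v) = (q v).[t]) ->
  (forall v, (size (q v) <= r.+1)%N) ->
  lspan (fun G => exists2 alpha : {ffun 'I_p -> nat}, (r <= order alpha)%N & G = lead (monom alpha))
    (fun v => (q v)`_r).
Proof.
move=> PF qE sq; have [M [N [F_ [PFj wFj FM Fsum]]]] := tor_decomp PF.
have /boolp.choice [qj Hq] (j : nat) : exists qj : X -> {poly K},
    (forall i, palgX (fun v => (qj v)`_i)) /\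
    forall t v, (F_ (space_act (uni t) v))`_j = (qj v).[t].
  by have [N' [q' [_ P' E']]] := uni_expand (PFj j); exists q'.
have sqj j v : (j < N)%N -> (size (qj j v) <= r.+1)%N.
  move=> jN; apply/leq_sizeP => i ri.
  have e0 c : c != 0 -> (\sum_(k < N) (qj k v)`_i *: 'X^k).[c] = 0.
    move=> c0.
    have : c ^+ M *: (q (space_act (tor c) v) \Po (c ^+ 2 *: 'X)) = \sum_(k < N) c ^+ k *: qj k v.
      apply: poly_eval_eq => t _; rewrite hornerZ horner_comp hornerZ hornerX -qE -uni_tor // FM //.
      by rewrite horner_sum; apply: eq_bigr => k _; rewrite hornerZ (Hq k).2.
    move/(congr1 (fun q : {poly K} => q`_i)); rewrite coefZ coef_comp_scale [(q _)`_i]nth_default; last first.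
      exact: leq_trans (sq _) ri.
    rewrite !mulr0 horner_sum coef_sum => e; rewrite [RHS]e; apply: eq_bigr => k _.
    by rewrite hornerZ hornerXn coefZ mulrC.
  have : \sum_(k < N) (qj k v)`_i *: 'X^k = 0.
    by apply: poly_eval_eq => c c0; rewrite e0 // horner0.
  move/(congr1 (fun q : {poly K} => q`_j)); rewrite coef0 coef_sum (bigD1 (Ordinal jN)) //=.
  rewrite coefZ coefXn eqxx mulr1 big1 ?addr0 // => k kj; rewrite coefZ coefXn.
  by rewrite eq_sym -val_eqE in kj; rewrite (negbTE kj) mulr0.
have qsum v : q v = \sum_(j < N) qj j v.
  apply: poly_eval_eq => t _; rewrite -qE Fsum horner_sum; apply: eq_bigr => j _.
  by rewrite (Hq j).2.
have -> : (fun v => (q v)`_r) = fun v => \sum_(j < N) (qj j v)`_r.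
  by apply/funext => v; rewrite qsum coef_sum.
have cl := lspan_closed (fun G => exists2 alpha : {ffun 'I_p -> nat}, (r <= order alpha)%N & G = lead (monom alpha)).
apply: lclosed_sum => // j _ _.
have jN : (j < N)%N by [].
(* Component [j] has weight [j - M]; beyond [r] it vanishes by [weight_bound]. *)
have [jM|Mj] := leqP j (M + r); last first.
  have F0 : forall v, (F_ v)`_j = 0.
    apply: (weight_bound (PFj j) (wFj j) (Hq j).1) Mj; last exact: (Hq j).2.
    by move=> v; apply: sqj.
  rewrite (_ : (fun _ => _) = fun=> 0); first by case: cl.
  apply/funext => v; rewrite (_ : qj j v = 0) ?coef0 //.
  by apply: poly_eval_eq => t _; rewrite -(Hq j).2 F0 horner0.
(* Each power of t lowers the weight by 2, so the coefficient of t^r has weight j - M - 2r. Its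
   order M + 2r - j is at least [r] exactly because [j <= M + r]. *)
have wG : weight (M + r.*2 - j) 0 (fun v => (qj j v)`_r).
  move=> c v c0; rewrite mul1r.
  have : c ^+ M *: (qj j (space_act (tor c) v) \Po (c ^+ 2 *: 'X)) = c ^+ j *: qj j v.
    apply: poly_eval_eq => t _; rewrite !hornerZ horner_comp hornerZ hornerX -!(Hq j).2 -uni_tor //.
    by rewrite wFj.
  move/(congr1 (fun q : {poly K} => q`_r)); rewrite !coefZ coef_comp_scale -exprM mul2n mulrA -exprD => e.
  apply: (mulfI (expf_neq0 j c0)); rewrite mulrA -exprD subnKC ?e //.
  by rewrite (leq_trans jM) // leq_add2l -addnn leq_addr.
have uG t v : (qj j (space_act (uni t) v))`_r = (qj j v)`_r.
  rewrite -[RHS](@coef_comp_shift _ _ t) ?sqj //; congr ((polyseq _)`_r).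
  apply: poly_eval_eq => s _; rewrite horner_comp hornerD hornerX hornerC -!(Hq j).2.
  by rewrite uniD.
have [C0 CD CM] := cl.
have [H] := lead_weight_span (lift_covariant ((Hq j).1 r) uG wG) wG.
apply: (H _ cl) => G [alpha oa ->]; apply: lspan_gen; exists alpha => //.
by rewrite oa -addnn; lia.
Qed.

End OneSpace.

(** * Transvectants *)

Lemma map_mderiv (n : nat) (R S : nzRingType) (h : {rmorphism R -> S}) (i : 'I_n) (p : {mpoly R[n]}) :
  map_mpoly h (p^`M(i)) = (map_mpoly h p)^`M(i).
Proof. by apply/mpolyP => m; rewrite mcoeff_map_mpoly !mcoeff_mderiv mcoeff_map_mpoly raddfMn. Qed.

Lemma comp_mpolyM (n k : nat) (R : comNzRingType) (t : n.-tuple {mpoly R[k]}) (p q : {mpoly R[n]}) :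
  (p * q) \mPo t = (p \mPo t) * (q \mPo t).
Proof. exact: rmorphM. Qed.

(** * Transvectants of binary forms over the base field, and their equivariance *)

Section Symbolic.
Variable K : fieldType.
Local Notation S4 := {mpoly K[2 + 2]}.
Implicit Types (F G A : S4) (p q : {mpoly K[2]}).

Definition omega F : S4 := F^`M(yb)^`M(xa) - F^`M(xb)^`M(ya).

Definition polar (x : 'I_2 -> K) (i j : 'I_(2 + 2)) F : S4 := x 0 *: F^`M(i) + x 1 *: F^`M(j).

Definition subst (z : 'I_2 -> 'I_(2 + 2)) p : S4 := p \mPo [tuple 'X_(z k) | k < 2].

Definition form_transvectant (m l r : nat) (x : 'I_2 -> K) p q : K :=
  (iter r omega (iter (m - r) (polar x xa ya) (iter (l - r) (polar x xb yb)
    (subst (@lshift 2 2) p * subst (@rshift 2 2) q))))@_0.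

(** The operators differentiate in the symbolic variables only, so specializing v and x commutes
    with them and the computation moves to scalar coefficients. *)
Lemma meval_transvectant (V : binary_space) m l r (P Q : coord_ring K V) v x :
  (r <= m)%N -> (r <= l)%N ->
  (transvectant m l r P Q).@[pair_fun v x] = form_transvectant m l r x (form_at v P) (form_at v Q).
Proof.
move=> rm rl; rewrite /transvectant leq_min rm rl /form_transvectant /=.
rewrite -(mcoeff_map_mpoly (meval (pair_fun v x))); congr (_@_0).
have put_form z (U : coord_ring K V) :
    map_mpoly (meval (pair_fun v x)) (put z U) = subst z (form_at v U).
  pose c4 : {rmorphism K -> symb_ring K V} := (@mpolyC (2 + 2) (coord_ring K V)) \o (@mpolyC (dim V + 2) K).
  rewrite /subst (_ : put z = mmap c4 (pair_fun (fun j => ('X_(lshift 2 j))%:MP) (fun k => 'X_(z k)))) //.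
  rewrite /form_at; elim/mpoly_alg_ind: U => [c|i|U W|U W].
  - by rewrite !mmapC comp_mpolyC map_mpolyC /= mevalC.
  - rewrite !mmapX !mmap1U -(splitK i); case: split => j /=.
      by rewrite !pair_fun_l comp_mpolyC map_mpolyC /= mevalXU pair_fun_l.
    by rewrite !pair_fun_r comp_mpolyXU -tnth_nth tnth_mktuple /= map_mpolyX.
  - move=> e1 e2; rewrite [mmap c4 _ _]raddfD [mmap _ _ (U + W)]raddfD [LHS]raddfD [RHS]raddfD.
    exact: (congr2 +%R e1 e2).
  - move=> e1 e2; rewrite [mmap c4 _ _]rmorphM [mmap _ _ (U * W)]rmorphM [LHS]rmorphM [RHS]rmorphM.
    exact: (congr2 *%R e1 e2).
have omE (F : symb_ring K V) : map_mpoly (meval (pair_fun v x)) (Omega F) = omega (map_mpoly (meval (pair_fun v x)) F).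
  by rewrite /Omega /omega rmorphB /= !map_mderiv.
have sgE i j (F : symb_ring K V) : map_mpoly (meval (pair_fun v x)) (sigma i j F) =
    polar x i j (map_mpoly (meval (pair_fun v x)) F).
  rewrite /sigma /polar rmorphD !rmorphM /= !map_mderiv !map_mpolyC /= !mevalXU !pair_fun_r.
  by rewrite !mul_mpolyC.
have omI n (F : symb_ring K V) : map_mpoly (meval (pair_fun v x)) (iter n (@Omega K V) F) =
    iter n omega (map_mpoly (meval (pair_fun v x)) F).
  by elim: n => //= n <-; rewrite omE.
have sgI n i j (F : symb_ring K V) : map_mpoly (meval (pair_fun v x)) (iter n (sigma i j) F) =
    iter n (polar x i j) (map_mpoly (meval (pair_fun v x)) F).
  by elim: n => //= n <-; rewrite sgE.
rewrite omI !sgI; congr (iter _ _ (iter _ _ (iter _ _ _))); rewrite -!put_form; exact: rmorphM.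
Qed.

Lemma mcoeff0_meval n (p : {mpoly K[n]}) : p@_0 = p.@[fun=> 0].
Proof.
elim/mpoly_alg_ind: p => [c|i|p q|p q].
- by rewrite mcoeffC eqxx mulr1 mevalC.
- by rewrite mcoeffX mnm1_eq0 mevalXU.
- by rewrite mcoeffD mevalD => -> ->.
- by rewrite mevalM => <- <-; exact: (rmorphM (mcoeff 0%MM)).
Qed.

Definition act4 (h : 'M[K]_2) : (2 + 2).-tuple S4 :=
  [tuple pair_fun (fun k => h k 0 *: 'X_xa + h k 1 *: 'X_ya)
                  (fun k => h k 0 *: 'X_xb + h k 1 *: 'X_yb) i | i < 2 + 2].

Lemma act4_l h k : tnth (act4 h) (lshift 2 k) = h k 0 *: 'X_xa + h k 1 *: 'X_ya.
Proof. by rewrite tnth_mktuple pair_fun_l. Qed.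

Lemma act4_r h k : tnth (act4 h) (rshift 2 k) = h k 0 *: 'X_xb + h k 1 *: 'X_yb.
Proof. by rewrite tnth_mktuple pair_fun_r. Qed.

Lemma subst_lin2 h p (z : 'I_2 -> 'I_(2 + 2)) :
  (forall k, tnth (act4 h) (z k) = h k 0 *: 'X_(z 0) + h k 1 *: 'X_(z 1)) ->
  subst z p \mPo act4 h = subst z (p \mPo lin2 h).
Proof.
move=> hz; rewrite /subst; elim/mpoly_alg_ind: p => [c|i|p q|p q].
- by rewrite !comp_mpolyC.
- rewrite !comp_mpolyXU -!tnth_nth tnth_mktuple comp_mpolyXU -tnth_nth hz tnth_lin2.
  by rewrite comp_mpolyD !comp_mpolyZ !comp_mpolyXU -!tnth_nth !tnth_mktuple.
- move=> e1 e2; rewrite (comp_mpolyD _ p) (comp_mpolyD (lin2 h) p) [LHS]comp_mpolyD.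
  rewrite e1 e2; exact/esym/comp_mpolyD.
- move=> e1 e2; rewrite (comp_mpolyM _ p) (comp_mpolyM (lin2 h) p) [LHS]comp_mpolyM.
  rewrite e1 e2; exact/esym/comp_mpolyM.
Qed.

(** The chain rule for a linear substitution; [z] selects one of the two symbolic pairs. *)
Lemma mderiv_act4 h F (z : 'I_2 -> 'I_(2 + 2)) j : z = @lshift 2 2 \/ z = @rshift 2 2 ->
  (F \mPo act4 h)^`M(z j) = h 0 j *: (F^`M(z 0) \mPo act4 h) + h 1 j *: (F^`M(z 1) \mPo act4 h).
Proof.
move=> hz; elim/mpoly_alg_ind: F => [c|i|F G|F G].
- by rewrite comp_mpolyC !mderivC comp_mpoly0 !scaler0 addr0.
- rewrite comp_mpolyXU -tnth_nth !mderivX !mnm1E !comp_mpolyZ.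
  have dX (k l : 'I_(2 + 2)) : (k == l)%:R *: ('X_[(U_(k) - U_(l))%MM] : S4) = (k == l)%:R.
    by case: eqP => [->|_]; rewrite ?scale0r // -[X in (X - _)%MM]add0m addmK mpolyX0 scale1r.
  have cX (k l : 'I_(2 + 2)) : (k == l)%:R *: ('X_[(U_(k) - U_(l))%MM] \mPo act4 h : S4) = (k == l)%:R.
    by rewrite -comp_mpolyZ dX rmorph_nat.
  rewrite !cX -(splitK i); case: split => k; rewrite /= ?act4_l ?act4_r mderivD !mderivZ !mderivX !mnm1E !dX.
  - case: hz => ->; case: (ord2 j) => ->; case: (ord2 k) => ->;
      by rewrite -!val_eqE /= ?scaler0 ?addr0 ?add0r.
  - case: hz => ->; case: (ord2 j) => ->; case: (ord2 k) => ->;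
      by rewrite -!val_eqE /= ?scaler0 ?addr0 ?add0r.
- rewrite (mderivD (z 0)) (mderivD (z 1)).
  move: (F^`M(z 0)) (F^`M(z 1)) (G^`M(z 0)) (G^`M(z 1)) => F0 F1 G0 G1 e1 e2.
  by rewrite (comp_mpolyD _ F) (comp_mpolyD _ F0) (comp_mpolyD _ F1) mderivD e1 e2 !scalerDr addrACA.
- rewrite (mderivM (z 0)) (mderivM (z 1)).
  move: (F^`M(z 0)) (F^`M(z 1)) (G^`M(z 0)) (G^`M(z 1)) => F0 F1 G0 G1 e1 e2.
  rewrite (comp_mpolyM _ F) mderivM e1 e2 (comp_mpolyD _ (F0 * G)) (comp_mpolyD _ (F1 * G)) !comp_mpolyM.
  rewrite -!mul_mpolyC; move: (F \mPo _) (G \mPo _) (F0 \mPo _) (F1 \mPo _) (G0 \mPo _) (G1 \mPo _).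
  by move=> A B A0 A1 B0 B1; ring.
Qed.

Lemma omega_act4 h F : omega (F \mPo act4 h) = \det h *: (omega F \mPo act4 h).
Proof.
have da := mderiv_act4 h _ _ (or_introl (erefl (@lshift 2 2))).
have db := mderiv_act4 h _ _ (or_intror (erefl (@rshift 2 2))).
rewrite /omega /xa /ya /xb /yb !db !mderivD !mderivZ !da comp_mpolyB (mat2_eta h) det_mat2 -!(mat2_eta h).
move: (_ \mPo _) (_ \mPo _) (_ \mPo _) (_ \mPo _) => A B C D.
rewrite -!mul_mpolyC !mpolyCB !mpolyCM; ring.
Qed.

Lemma polar_act4 g h F x (z : 'I_2 -> 'I_(2 + 2)) : z = @lshift 2 2 \/ z = @rshift 2 2 ->
  h *m g = 1%:M ->
  polar (plane_act g x) (z 0) (z 1) (F \mPo act4 h) = polar x (z 0) (z 1) F \mPo act4 h.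
Proof.
move=> hz hg; rewrite /polar !(mderiv_act4 _ _ _ hz) comp_mpolyD !comp_mpolyZ.
rewrite -{3}[x]plane_act1 -{4}[x]plane_act1 -hg plane_actM; move: (plane_act g x) => y.
rewrite /plane_act !big_ord2 /=; move: (_ \mPo _) (_ \mPo _) => A B.
rewrite -!mul_mpolyC !mpolyCD !mpolyCM; ring.
Qed.

Lemma form_transvectant_act m l r g x p q : \det g = 1 ->
  form_transvectant m l r (plane_act g x) (p \mPo lin2 (invmx g)) (q \mPo lin2 (invmx g)) =
  form_transvectant m l r x p q.
Proof.
move=> D; have gU := det1_unit D; rewrite /form_transvectant !mcoeff0_meval.
rewrite -(subst_lin2 (h := invmx g)) => [|k]; last exact: act4_l.
rewrite -(subst_lin2 (h := invmx g)) => [|k]; last exact: act4_r.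
have hg : invmx g *m g = 1%:M by rewrite mulVmx.
have pa F : polar (plane_act g x) xa ya (F \mPo act4 (invmx g)) = polar x xa ya F \mPo act4 (invmx g).
  exact: (@polar_act4 g _ F x _ (or_introl (erefl (@lshift 2 2)))).
have pb F : polar (plane_act g x) xb yb (F \mPo act4 (invmx g)) = polar x xb yb F \mPo act4 (invmx g).
  exact: (@polar_act4 g _ F x _ (or_intror (erefl (@rshift 2 2)))).
have om F : omega (F \mPo act4 (invmx g)) = omega F \mPo act4 (invmx g).
  by rewrite omega_act4 det_inv D invr1 scale1r.
have it n (f f' : S4 -> S4) F : (forall G, f (G \mPo act4 (invmx g)) = f' G \mPo act4 (invmx g)) ->
    iter n f (F \mPo act4 (invmx g)) = iter n f' F \mPo act4 (invmx g).
  by move=> ff; elim: n => //= n ->.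
rewrite -rmorphM /= (it _ _ (polar x xb yb)) // (it _ _ (polar x xa ya)) // (it _ _ omega) //.
rewrite comp_mpoly_meval; apply: meval_eq => i.
rewrite -(splitK i); case: split => k; rewrite /= ?act4_l ?act4_r.
  by rewrite mevalD !mevalZ !mevalXU !mulr0 addr0.
by rewrite mevalD !mevalZ !mevalXU !mulr0 addr0.
Qed.

End Symbolic.

(** * Constant-coefficient operators evaluated at the origin *)

Section ApolarPairing.
Variables (K : fieldType) (n : nat).
Implicit Types A B G : {mpoly K[n]}.

(* The constant term of A(d/dx) G. *)
Definition apolar A G : K := \sum_(m <- msupp G) A@_m * (G^`M[m])@_0.

Lemma mderivm_coeff0 G m : (G^`M[m])@_0 = G@_m * (\prod_(i < n) (m i)`!)%:R.
Proof.
rewrite mcoeff_mderivm addm0 -[LHS]mulr_natr; congr (_ * _%:R).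
by apply: eq_bigr => i _; rewrite ffactnn.
Qed.

Lemma apolarX m G : apolar 'X_[m] G = (G^`M[m])@_0.
Proof.
rewrite /apolar; have [mG|mG] := boolP (m \in msupp G).
  rewrite (bigD1_seq m) ?msupp_uniq //= mcoeffX eqxx mul1r big1 ?addr0 // => k km.
  by rewrite mcoeffX eq_sym (negbTE km) mul0r.
rewrite mderivm_coeff0 (memN_msupp_eq0 mG) mul0r big_seq big1 // => k kG.
by rewrite mcoeffX; case: eqP => [mk|_]; rewrite ?mul0r //; rewrite mk kG in mG.
Qed.

Lemma apolarDl A B G : apolar (A + B) G = apolar A G + apolar B G.
Proof. by rewrite /apolar -big_split; apply: eq_bigr => m _; rewrite mcoeffD mulrDl. Qed.

Lemma apolarZl c A G : apolar (c *: A) G = c * apolar A G.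
Proof. by rewrite /apolar mulr_sumr; apply: eq_bigr => m _; rewrite mcoeffZ mulrA. Qed.

Lemma apolarBl A B G : apolar (A - B) G = apolar A G - apolar B G.
Proof. by rewrite apolarDl -scaleN1r apolarZl mulN1r. Qed.

Lemma apolar0l G : apolar 0 G = 0.
Proof. by rewrite /apolar big1 // => m _; rewrite mcoeff0 mul0r. Qed.

Lemma apolar_suml (I : Type) (r : seq I) (F : I -> {mpoly K[n]}) G :
  apolar (\sum_(i <- r) F i) G = \sum_(i <- r) apolar (F i) G.
Proof. by elim/big_rec2: _ => [|i y x _ <-]; rewrite ?apolar0l ?apolarDl. Qed.

Lemma apolarBr A F G : apolar A (F - G) = apolar A F - apolar A G.
Proof.
elim/mpolyind: A => [|c m A _ _ IH]; first by rewrite !apolar0l subrr.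
by rewrite !apolarDl !apolarZl !apolarX IH mderivmB mcoeffB; ring.
Qed.

(** Adjunction: a derivative of [G] becomes a factor of the symbol, so a composite of operators is
    replaced by a product of polynomials. *)
Lemma apolar_mderiv A G i : apolar A (G^`M(i)) = apolar ('X_i * A) G.
Proof.
elim/mpolyind: A => [|c m A _ _ IH]; first by rewrite mulr0 !apolar0l.
rewrite mulrDr -scalerAr -mpolyXD !apolarDl !apolarZl IH !apolarX.
by rewrite mderivmDm mderivmU1m.
Qed.

Lemma apolar1 G : apolar 1 G = G@_0.
Proof. by rewrite -mpolyX0 apolarX mderivm0m. Qed.

End ApolarPairing.

(** * The leading coefficient of a transvectant *)

Section TransvectantFormula.
Variable K : fieldType.
Local Notation S4 := {mpoly K[2 + 2]}.

Definition mon4 (i j k l : nat) : 'X_{1..2 + 2} :=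
  (U_(xa) *+ i + U_(ya) *+ j + U_(xb) *+ k + U_(yb) *+ l)%MM.

Lemma mon4E i j k l : [/\ mon4 i j k l xa = i, mon4 i j k l ya = j, mon4 i j k l xb = k
  & mon4 i j k l yb = l].
Proof.
by split; rewrite /mon4 !mnmDE !mulmnE !mnm1E -!val_eqE /= ?mul0n ?mul1n ?addn0 ?add0n.
Qed.

Lemma mon4_ya i j k l : mon4 i j k l ya = j. Proof. by case: (mon4E i j k l). Qed.

Lemma mon4_yb i j k l : mon4 i j k l yb = l. Proof. by case: (mon4E i j k l). Qed.

Lemma mpolyX_mon4 i j k l : 'X_[mon4 i j k l] = 'X_xa ^+ i * 'X_ya ^+ j * 'X_xb ^+ k * 'X_yb ^+ l :> S4.
Proof. by rewrite /mon4 !mpolyXD !mpolyXn. Qed.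

Lemma mcoeff_subst_mul m l (p q : {mpoly K[2]}) k j :
  p \is m.-homog -> q \is l.-homog -> (k <= m)%N -> (j <= l)%N ->
  (subst (@lshift 2 2) p * subst (@rshift 2 2) q)@_(mon4 (m - k) k (l - j) j) =
  p@_(bmon m k) * q@_(bmon l j).
Proof.
move=> hp hq km0 jl0; have km : (k < m.+1)%N by []; have jl : (j < l.+1)%N by [].
have sE (z : 'I_2 -> 'I_(2 + 2)) N (s : {mpoly K[2]}) : s \is N.-homog -> subst z s =
    \sum_(k < N.+1) s@_(bmon N k) *: ('X_(z 0) ^+ (N - k) * 'X_(z 1) ^+ k).
  move=> /homog_bform {1}->; rewrite /subst /bform raddf_sum; apply: eq_bigr => i _ /=.
  by rewrite comp_mpolyZ comp_mpolyX big_ord2 /= bmon0 bmon1 !tnth_mktuple.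
rewrite (sE _ _ _ hp) (sE _ _ _ hq) big_distrlr /= raddf_sum (bigD1 (Ordinal km)) //= [X in _ + X]big1.
  rewrite addr0 raddf_sum (bigD1 (Ordinal jl)) //= [X in _ + X]big1.
    rewrite addr0 -scalerAl -scalerAr scalerA mcoeffZ mulrA -mpolyX_mon4 mcoeffX eqxx mulr1 //.
  move=> i; rewrite -val_eqE /= => ij.
  rewrite -scalerAl -scalerAr scalerA mcoeffZ mulrA -mpolyX_mon4 mcoeffX; case: eqP; rewrite ?mulr0 //.
  by move/(congr1 (fun mu : 'X_{1..2 + 2} => mu yb)); rewrite !mon4_yb => /eqP; rewrite (negbTE ij).
move=> i; rewrite -val_eqE /= => ik; rewrite raddf_sum big1 // => i' _ /=.
rewrite -scalerAl -scalerAr scalerA mcoeffZ mulrA -mpolyX_mon4 mcoeffX; case: eqP; rewrite ?mulr0 //.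
by move/(congr1 (fun mu : 'X_{1..2 + 2} => mu ya)); rewrite !mon4_ya => /eqP; rewrite (negbTE ik).
Qed.

(** At x = (1, 0) the polarizations reduce to the derivatives in [xa] and [xb], so the whole
    operator has constant coefficients and the displayed symbol. *)
Lemma mcoeff0_form_transvectant m l r p q :
  form_transvectant m l r (vec2 1 0) p q = @apolar K (2 + 2)
    ('X_xb ^+ (l - r) * ('X_xa ^+ (m - r) * ('X_xa * 'X_yb - 'X_ya * 'X_xb) ^+ r))
    (subst (@lshift 2 2) p * subst (@rshift 2 2) q).
Proof.
have po i j (F : S4) : polar (vec2 1 0) i j F = F^`M(i).
  by rewrite /polar /vec2 /= scale1r scale0r addr0.
have itd A i j c (F : S4) : apolar A (iter c (polar (vec2 1 0) i j) F) = apolar ('X_i ^+ c * A) F.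
  elim: c A => [|c IH] A; first by rewrite mul1r.
  by rewrite /= po apolar_mderiv IH exprSr mulrA.
have ito A c (F : S4) : apolar A (iter c (@omega K) F) = apolar (('X_xa * 'X_yb - 'X_ya * 'X_xb) ^+ c * A : S4) F.
  elim: c A => [|c IH] A; first by rewrite mul1r.
  rewrite /= {1}/omega apolarBr !apolar_mderiv -apolarBl IH exprSr -!mulrA; congr (apolar (_ * _) _).
  by rewrite [in RHS]mulrBl !mulrA (mulrC 'X_xa) (mulrC 'X_ya).
rewrite /form_transvectant -apolar1 ito !itd.
by rewrite mulr1.
Qed.

(** The binomial comes from expanding the r-th power of the symbol of [omega], the factorials from
    differentiating the matching monomial completely. *)
Definition transvectant_coef (m l r k : nat) : nat :=
  'C(r, k) * ((m - k)`! * k`! * (l - (r - k))`! * (r - k)`!).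

Lemma form_transvectantE m l r (p q : {mpoly K[2]}) : p \is m.-homog -> q \is l.-homog ->
  (r <= m)%N -> (r <= l)%N ->
  form_transvectant m l r (vec2 1 0) p q = \sum_(k < r.+1)
    (-1) ^+ k * (transvectant_coef m l r k)%:R * p@_(bmon m k) * q@_(bmon l (r - k)).
Proof.
move=> hp hq rm rl; rewrite mcoeff0_form_transvectant; set G := (X in apolar _ X).
rewrite exprBn !mulr_sumr apolar_suml.
apply: eq_bigr => k _; have kr : (k <= r)%N by rewrite -ltnS.
have -> : 'X_xb ^+ (l - r) * ('X_xa ^+ (m - r) * ((-1) ^+ k * ('X_xa * 'X_yb) ^+ (r - k) * ('X_ya * 'X_xb) ^+ k *+ 'C(r, k))) =
   ((-1) ^+ k * 'C(r, k)%:R) *: 'X_[mon4 (m - k) k (l - (r - k)) (r - k)] :> S4.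
  have -> : (m - k = (m - r) + (r - k))%N by lia.
  have -> : (l - (r - k) = (l - r) + k)%N by lia.
  rewrite mpolyX_mon4 -mul_mpolyC !exprD !exprMn mpolyCM rmorphXn rmorphN1 rmorph_nat -mulr_natr.
  move: ('X_xa ^+ (m - r)) ('X_xa ^+ (r - k)) ('X_xb ^+ (l - r)) ('X_xb ^+ k) ('X_ya ^+ k) ('X_yb ^+ (r - k)) ((-1) ^+ k) ('C(r, k)%:R).
  by move=> x1 x2 x3 x4 x5 x6 x7 x8; ring.
rewrite apolarZl apolarX mderivm_coeff0 /G (mcoeff_subst_mul hp hq); [|lia|lia].
rewrite /transvectant_coef natrM.
have -> : (\prod_(i < 2 + 2) (mon4 (m - k) k (l - (r - k)) (r - k) i)`! =
    (m - k)`! * k`! * (l - (r - k))`! * (r - k)`!)%N.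
  have [e1 e2 e3 e4] := mon4E (m - k) k (l - (r - k)) (r - k).
  rewrite big_split_ord /= !big_ord2 /= -/xa -/ya -/xb -/yb e1 e2 e3 e4; lia.
ring.
Qed.

(** After x is replaced by x - t y, the monomial of index j contributes t^(k - j) to the coefficient
    of index k; only the leading coefficient, j = 0, reaches t^k. *)
Lemma mcoeff_shear m (p : {mpoly K[2]}) k : p \is m.-homog -> (k <= m)%N ->
  exists s : {poly K}, [/\ (size s <= k.+1)%N,
    s`_k = (-1) ^+ k * 'C(m, k)%:R * p@_(bmon m 0)
    & forall t, (p \mPo lin2 (mat2 1 (- t) 0 1))@_(bmon m k) = s.[t]].
Proof.
move=> hp km; pose s := \sum_(j < m.+1) \sum_(i < (m - j).+1)
  (p@_(bmon m j) * (-1) ^+ i * 'C(m - j, i)%:R * (i + j == k)%N%:R) *: 'X^i : {poly K}.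
exists s; split.
- apply/leq_sizeP => n kn; rewrite coef_sum big1 // => j _; rewrite coef_sum big1 // => i _.
  rewrite coefZ coefXn; case: (n =P i) => [ni|_]; rewrite ?mulr0 //.
  by case: eqP => [ijk|_]; rewrite ?mulr0 ?mul0r //; exfalso; lia.
- rewrite coef_sum (bigD1 ord0) //= [X in _ + X]big1 ?addr0.
    have km1 : (k < (m - 0).+1)%N by rewrite subn0.
    rewrite coef_sum (bigD1 (Ordinal km1)) //= [X in _ + X]big1 ?addr0.
      by rewrite coefZ coefXn addn0 subn0 !eqxx !mulr1 -mulrA mulrC.
    move=> i; rewrite -val_eqE /= => ik; rewrite coefZ addn0 (negbTE ik) mulr0 mul0r //.
  move=> j; rewrite -val_eqE /= => j0; rewrite coef_sum big1 // => i _.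
  rewrite coefZ coefXn; case: (k =P i) => [ki|_]; rewrite ?mulr0 //.
  by case: eqP => [ijk|_]; rewrite ?mulr0 ?mul0r //; exfalso; lia.
move=> t; rewrite {1}(homog_bform hp) /bform [X in X@__]raddf_sum [LHS]raddf_sum /s horner_sum.
apply: eq_bigr => j _; have jm : (j <= m)%N by rewrite -ltnS.
rewrite /= comp_mpolyZ mcoeffZ comp_mpolyX big_ord2 /= !tnth_lin2 bmon0 bmon1 !mxE /= scale1r scale0r add0r scale1r.
rewrite scaleNr exprBn mulr_suml raddf_sum mulr_sumr horner_sum; apply: eq_bigr => i _.
have im : (i <= m - j)%N by rewrite -ltnS.
have -> : (-1) ^+ i * 'X_0 ^+ (m - j - i) * (t *: 'X_1) ^+ i *+ 'C(m - j, i) * 'X_1 ^+ j =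
    ((-1) ^+ i * t ^+ i * 'C(m - j, i)%:R) *: 'X_[bmon m (i + j)] :> {mpoly K[2]}.
  rewrite exprZn /bmon mpolyXD -!mpolyXn -!mul_mpolyC !mpolyCM !rmorphXn rmorphN1 rmorph_nat -mulr_natr.
  have -> : (m - (i + j) = m - j - i)%N by lia.
  rewrite exprD; move: ((-1) ^+ i) ('X_0 ^+ _) ('X_1 ^+ i) ('X_1 ^+ j) (t%:MP ^+ i) ('C(_, _)%:R).
  by move=> x1 x2 x3 x4 x5 x6; ring.
rewrite /= mcoeffZ mcoeffX hornerZ hornerXn.
have -> : (bmon m (i + j) == bmon m k) = (i + j == k)%N.
  apply/eqP/eqP => [/(congr1 (fun mu : 'X_{1..2} => mu 1))|-> //]; by rewrite !bmon1.
ring.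
Qed.

End TransvectantFormula.

(** * Transvectants of a covariant of V1 with a covariant of V2 *)

Section CovariantTransvectants.
Variable K : numFieldType.

Lemma meval_lin2 (p : {mpoly K[2]}) h x : (p \mPo lin2 h).@[x] = p.@[plane_act h x].
Proof.
rewrite comp_mpoly_meval; apply: meval_eq => i.
by rewrite tnth_lin2 mevalD !mevalZ !mevalXU /plane_act big_ord2.
Qed.

Lemma form_at_act V (P : coord_ring K V) g v : Cov P -> \det g = 1 ->
  form_at (space_act g v) P = form_at v P \mPo lin2 (invmx g).
Proof.
move=> cP D; apply: meval_inj => x; rewrite meval_lin2 !meval_form_at -[RHS](cP g) //.
by rewrite -plane_actM mulmxV ?plane_act1 // det1_unit.
Qed.

Lemma Cov_transvectant V m l r (P Q : coord_ring K V) :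
  Cov P -> Cov Q -> Cov (transvectant m l r P Q).
Proof.
move=> cP cQ g v x D; have [/andP[rm rl]|] := boolP ((r <= m)%N && (r <= l)%N).
  rewrite !(meval_transvectant _ _ _ _ rm rl) (form_at_act _ cP D) (form_at_act _ cQ D).
  exact: form_transvectant_act.
by rewrite /transvectant leq_min => /negbTE ->; rewrite !meval0.
Qed.

Section Inclusions.
Variables V1 V2 : binary_space.

Lemma meval_inclL (P : coord_ring K V1) v1 v2 x :
  (inclL V2 P).@[pair_fun (join v1 v2) x] = P.@[pair_fun v1 x].
Proof.
rewrite comp_mpoly_meval; apply: meval_eq => i; rewrite tnth_mktuple -(splitK i).
case: split => j /=; rewrite ?pair_fun_l ?pair_fun_r mevalXU ?pair_fun_l ?pair_fun_r //.
exact: join_l.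
Qed.

Lemma meval_inclR (P : coord_ring K V2) v1 v2 x :
  (inclR V1 P).@[pair_fun (join v1 v2) x] = P.@[pair_fun v2 x].
Proof.
rewrite comp_mpoly_meval; apply: meval_eq => i; rewrite tnth_mktuple -(splitK i).
case: split => j /=; rewrite ?pair_fun_l ?pair_fun_r mevalXU ?pair_fun_l ?pair_fun_r //.
exact: join_r.
Qed.

Lemma form_at_inclL (P : coord_ring K V1) v1 v2 : form_at (join v1 v2) (inclL V2 P) = form_at v1 P.
Proof. by apply: meval_inj => x; rewrite !meval_form_at meval_inclL. Qed.

Lemma form_at_inclR (P : coord_ring K V2) v1 v2 : form_at (join v1 v2) (inclR V1 P) = form_at v2 P.
Proof. by apply: meval_inj => x; rewrite !meval_form_at meval_inclR. Qed.

Lemma Cov_inclL (P : coord_ring K V1) : Cov P -> Cov (inclL V2 P).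
Proof.
move=> cP g v x D; have [v1 [v2 ->]] := join_eta v.
by rewrite space_act_join !meval_inclL cP.
Qed.

Lemma Cov_inclR (P : coord_ring K V2) : Cov P -> Cov (inclR V1 P).
Proof.
move=> cP g v x D; have [v1 [v2 ->]] := join_eta v.
by rewrite space_act_join !meval_inclR cP.
Qed.

Lemma lead_homog V (P : coord_ring K V) v m : form_at v P \is m.-homog ->
  lead P v = (form_at v P)@_(bmon m 0).
Proof.
move=> hP; rewrite /lead -meval_form_at {1}(homog_bform hP) /bform raddf_sum (bigD1 ord0) //=.
rewrite [X in _ + X]big1 ?addr0 => [|k k0].
  by rewrite mevalZ mevalX big_ord2 /= bmon0 bmon1 /vec2 /= expr1n mulr1 mulr1.
rewrite mevalZ mevalX big_ord2 /= bmon1 /vec2 /= expr0n; rewrite -val_eqE /= in k0.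
by rewrite (negbTE k0) !mulr0.
Qed.

(** By [mcoeff_shear], term k of [form_transvectantE] has degree at most k in t. So t^r comes from
    [k = r] alone, where the V2 factor has index r - r = 0 and is the leading coefficient of [Q]. *)
Lemma transvectant_top m l r (P : coord_ring K V1) (Q : coord_ring K V2) :
  Cov P -> (forall v, form_at v P \is m.-homog) -> (forall v, form_at v Q \is l.-homog) ->
  (r <= m)%N -> (r <= l)%N ->
  exists2 kappa : K, kappa != 0 & forall v1 v2, exists q : {poly K},
    [/\ (size q <= r.+1)%N, q`_r = kappa * (lead P v1 * lead Q v2)
      & forall t, lead (transvectant m l r (inclL V2 P) (inclR V1 Q)) (join (space_act (uni t) v1) v2) = q.[t]].
Proof.
(* The coefficient of the last term times the binomial of [mcoeff_shear]; their two signs (-1)^r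
   cancel, and [r <= m] keeps the product nonzero. *)
move=> cP hP hQ rm rl; exists ((transvectant_coef m l r r * 'C(m, r))%:R).
  by rewrite Num.Theory.pnatr_eq0 -lt0n /transvectant_coef !muln_gt0 !fact_gt0 binn bin_gt0 rm.
move=> v1 v2.
have /boolp.choice [s Hs] (k : nat) : exists s : {poly K}, (k <= m)%N -> [/\ (size s <= k.+1)%N,
    s`_k = (-1) ^+ k * 'C(m, k)%:R * (form_at v1 P)@_(bmon m 0)
    & forall t, (form_at v1 P \mPo lin2 (mat2 1 (- t) 0 1))@_(bmon m k) = s.[t]].
  case: (leqP k m) => km; last by exists 0.
  by have [s Hs] := mcoeff_shear (hP v1) km; exists s.
exists (\sum_(k < r.+1) ((-1) ^+ k * (transvectant_coef m l r k)%:R * (form_at v2 Q)@_(bmon l (r - k))) *: s k).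
split.
- apply: (leq_trans (size_sum _ _ _)); apply/bigmax_leqP => k _.
  have kr : (k <= r)%N by rewrite -ltnS.
  have [sk _ _] := Hs k (leq_trans kr rm).
  by apply: leq_trans (size_scale_leq _ _) _; apply: leq_trans sk _.
- rewrite coef_sum big_ord_recr /= big1 ?add0r => [|k _]; last first.
    have [sk _ _] := Hs k (leq_trans (ltnW (ltn_ord k)) rm).
    by rewrite coefZ nth_default ?mulr0 // (leq_trans sk).
  have [_ sr _] := Hs r rm; rewrite coefZ sr subnn (lead_homog (hP v1)) (lead_homog (hQ v2)) natrM.
  have : (-1) ^+ r * (-1) ^+ r = 1 :> K by rewrite -expr2 sqrr_sign.
  move: ((-1) ^+ r) (_@__) (_@__) (_%:R) (_%:R) => e x y c1 c2 e2.
  by rewrite -[RHS]mul1r -e2; ring.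
- move=> t; rewrite /lead meval_transvectant // form_at_inclL form_at_inclR form_at_act ?det_uni //.
  rewrite invmx_uni form_transvectantE ?mcomp_lin2_homog // horner_sum; apply: eq_bigr => k _.
  have kr : (k <= r)%N by rewrite -ltnS.
  have [_ _ sE] := Hs k (leq_trans kr rm).
  by rewrite hornerZ sE mulrAC.
Qed.

End Inclusions.
End CovariantTransvectants.

(** * Tensor decomposition *)

Section Tensor.
Variables (K : fieldType) (T1 T2 : Type).

Definition tensor (p : T1 -> K) (q : T2 -> K) (x : T1 * T2) : K := p x.1 * q x.2.

Definition tensor_sum (r : seq ((T1 -> K) * (T2 -> K))) (x : T1 * T2) : K :=
  \sum_(pq <- r) tensor pq.1 pq.2 x.

Lemma sum_neq0_split (I : Type) (r : seq I) (F : I -> K) : \sum_(i <- r) F i != 0 ->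
  exists r1 i r2, r = r1 ++ i :: r2 /\ F i != 0.
Proof.
elim: r => [|i r IH]; first by rewrite big_nil eqxx.
rewrite big_cons; have [Fi|Fi _] := eqVneq (F i) 0; last by exists [::], i, r.
by rewrite Fi add0r => /IH [r1 [j [r2 [-> Fj]]]]; exists (i :: r1), j, r2.
Qed.

(* Wedderburn rank reduction: subtracting w(x,y0) w(x0,y) / w(x0,y0) lowers the
   rank by one and only involves slices of w. *)
Lemma tensor_sum_span (S1 : (T1 -> K) -> Prop) (S2 : (T2 -> K) -> Prop) r :
  lclosed S1 -> lclosed S2 ->
  (forall y, S1 (fun x => tensor_sum r (x, y))) -> (forall x, S2 (fun y => tensor_sum r (x, y))) ->
  lspan (fun G => exists p q, [/\ S1 p, S2 q & G = tensor p q]) (tensor_sum r).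
Proof.
move=> c1 c2; have [n] := ubnP (size r); elim: n r => // n IH r sr H1 H2.
set G := (fun G => _); have cl := lspan_closed G; have [C0 CD CM] := cl.
have [/existsNP [[x0 y0] w0]|w0] := boolp.EM (~ forall x, tensor_sum r x = 0); last first.
  rewrite (_ : tensor_sum r = fun=> 0) //; apply/funext => x; move/boolp.contrapT: w0; exact.
move/eqP: w0 => w0; have [r1 [[p0 q0] [r2 [re Fk]]]] := sum_neq0_split w0.
have q00 : q0 y0 != 0 by move: Fk; rewrite /tensor /= mulf_eq0 negb_or => /andP[].
(* Correcting the first factors subtracts the rank-one term and makes the slice at y0 vanish. Hence
   correcting the second factors by multiples of [q0] leaves the sum unchanged, while it kills the
   summand with factor [q0]. *)
pose w := tensor_sum r; pose f (pq : (T1 -> K) * (T2 -> K)) : (T1 -> K) * (T2 -> K) :=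
  (fun x => pq.1 x - pq.1 x0 / w (x0, y0) * w (x, y0), fun y => pq.2 y - pq.2 y0 / q0 y0 * q0 y).
have wE x : tensor_sum (map f (r1 ++ r2)) x = w x - (w (x0, y0))^-1 * tensor (fun x => w (x, y0)) (fun y => w (x0, y)) x.
  have -> : tensor_sum (map f (r1 ++ r2)) x = tensor_sum (map f r) x.
    rewrite re /tensor_sum !map_cat !big_cat big_cons /=.
    by rewrite [X in _ = _ + (X + _)](_ : _ = 0) ?add0r // /tensor /= mulfV // mul1r subrr mulr0.
  case: x => x y; rewrite /tensor_sum big_map /tensor /=.
  transitivity (\sum_(pq <- r) (pq.1 x * pq.2 y) - w (x, y0) / w (x0, y0) * (\sum_(pq <- r) pq.1 x0 * pq.2 y)
     - q0 y / q0 y0 * (\sum_(pq <- r) pq.1 x * pq.2 y0 - w (x, y0) / w (x0, y0) * (\sum_(pq <- r) pq.1 x0 * pq.2 y0))).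
    rewrite !mulr_sumr -!sumrB mulr_sumr -sumrB; apply: eq_bigr => pq _.
    by field; rewrite w0 q00.
  rewrite -[\sum_(pq <- r) pq.1 x0 * pq.2 y0]/(w (x0, y0)) -[\sum_(pq <- r) pq.1 x * pq.2 y0]/(w (x, y0)).
  by rewrite -[\sum_(pq <- r) pq.1 x0 * pq.2 y]/(w (x0, y)) divfK // subrr mulr0 subr0 /w /tensor_sum /tensor /=; ring.
have -> : tensor_sum r = fun x => tensor_sum (map f (r1 ++ r2)) x +
    (w (x0, y0))^-1 * tensor (fun x => w (x, y0)) (fun y => w (x0, y)) x.
  by apply/funext => x; rewrite wE subrK.
have [_ D1 M1] := c1; have [_ D2 M2] := c2.
apply: CD; last first.
  apply: CM; apply: lspan_gen; exists (fun x => w (x, y0)), (fun y => w (x0, y)); split=> //.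
apply: IH.
- by rewrite size_map; move: sr; rewrite re !size_cat /= addnS ltnS.
- move=> y; rewrite (_ : (fun _ => _) = fun x => w (x, y) + (- ((w (x0, y0))^-1 * w (x0, y))) * w (x, y0)).
    by apply: D1; [exact: H1|apply: M1; exact: H1].
  by apply/funext => x; rewrite wE /tensor /=; ring.
- move=> x; rewrite (_ : (fun _ => _) = fun y => w (x, y) + (- ((w (x0, y0))^-1 * w (x, y0))) * w (x0, y)).
    by apply: D2; [exact: H2|apply: M2; exact: H2].
  by apply/funext => y; rewrite wE /tensor /=; ring.
Qed.

Lemma lspan_tensor (S1 : (T1 -> K) -> Prop) (S2 : (T2 -> K) -> Prop) p q :
  lspan S1 p -> lspan S2 q -> lspan (fun G => exists p q, [/\ S1 p, S2 q & G = tensor p q]) (tensor p q).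
Proof.
set G := (fun G => _); have [C0 CD CM] := lspan_closed G; move=> [Sp] [Sq].
have tq p' : S1 p' -> lspan G (tensor p' q).
  move=> p'S; apply: (Sq (fun q => lspan G (tensor p' q))) => [|q' q'S]; last first.
    by apply: lspan_gen; exists p', q'.
  split=> [|F F' IF IF'|c F IF].
  - by rewrite (_ : tensor _ _ = fun=> 0) //; apply/funext => x; rewrite /tensor mulr0.
  - rewrite (_ : tensor _ _ = fun x => tensor p' F x + tensor p' F' x); first exact: CD.
    by apply/funext => x; rewrite /tensor mulrDr.
  - rewrite (_ : tensor _ _ = fun x => c * tensor p' F x); first exact: CM.
    by apply/funext => x; rewrite /tensor mulrCA.
apply: (Sp (fun p => lspan G (tensor p q))) => //.
split=> [|F F' IF IF'|c F IF].
- by rewrite (_ : tensor _ _ = fun=> 0) //; apply/funext => x; rewrite /tensor mul0r.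
- rewrite (_ : tensor _ _ = fun x => tensor F q x + tensor F' q x); first exact: CD.
  by apply/funext => x; rewrite /tensor mulrDl.
- rewrite (_ : tensor _ _ = fun x => c * tensor F q x); first exact: CM.
  by apply/funext => x; rewrite /tensor mulrA.
Qed.

End Tensor.

Lemma palg_tensor_sum (K : fieldType) m n (w : ('I_m -> K) * ('I_n -> K) -> K) :
  palg (@coord2 K m n) w -> exists r, w = tensor_sum r.
Proof.
case=> Pw; apply: (Pw (fun w => exists r, w = tensor_sum r)); last first.
  case=> i; [exists [:: (fun v => v i, fun=> 1)]|exists [:: (fun=> 1, fun v => v i)]];
    by apply/funext => x; rewrite /tensor_sum big_seq1 /tensor /= ?mulr1 ?mul1r.
split=> [c|F G [r ->] [s ->]|F G [r ->] [s ->]].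
- by exists [:: (fun=> c, fun=> 1)]; apply/funext => x; rewrite /tensor_sum big_seq1 /tensor mulr1.
- by exists (r ++ s); apply/funext => x; rewrite /tensor_sum big_cat.
- exists [seq (fun v => pq.1 v * pq'.1 v, fun v => pq.2 v * pq'.2 v) | pq <- r, pq' <- s].
  apply/funext => x; rewrite /tensor_sum big_allpairs_dep big_distrlr /=.
  apply: eq_bigr => pq _; apply: eq_bigr => pq' _; rewrite /tensor /=; ring.
Qed.

(** * Finiteness of the irreducible solutions *)

Section Dickson.

(** Dickson's lemma. A finite set handles the tails; with chosen heads at most [N], it serves every
    tuple whose head is at least [N]. Each of the finitely many smaller heads is a slice covered by
    induction. *)
Lemma dickson (k : nat) (P : seq nat -> Prop) : exists L : seq (seq nat),
  (forall y, y \in L -> P y /\ size y = k) /\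
  forall x, size x = k -> P x -> exists2 y, y \in L & forall i, (nth 0 y i <= nth 0 x i)%N.
Proof.
elim: k P => [|k IH] P.
  have [P0|P0] := boolp.EM (P [::]); last first.
    by exists [::]; split=> // x /eqP; rewrite size_eq0 => /eqP ->.
  exists [:: [::]]; split=> [y|x]; first by rewrite inE => /eqP ->.
  by move=> /eqP; rewrite size_eq0 => /eqP -> _; exists [::]; rewrite ?inE.
have [L0 [L0P L0D]] := IH (fun y => exists n, P (n :: y)).
have /boolp.choice [hd Hhd] (y : seq nat) : exists n, (exists n, P (n :: y)) -> P (n :: y).
  by have [[n Pn]|nP] := boolp.EM (exists n, P (n :: y)); [exists n|exists 0%N].
pose N := (\max_(y <- L0) hd y)%N.
have /boolp.choice [Ln HLn] (n : nat) := IH (fun y => P (n :: y)).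
exists ([seq hd y :: y | y <- L0] ++ flatten [seq [seq n :: y | y <- Ln n] | n <- iota 0 N]).
split=> [y|[//|n x] [sx] Px].
  rewrite mem_cat => /orP[/mapP[y' /L0P [Q sy] ->]|/flatten_mapP[n _ /mapP[y' y'L ->]]].
    by split; [exact: Hhd|rewrite /= sy].
  by have [Py sy] := (HLn n).1 _ y'L; rewrite /= sy.
have [nN|Nn] := ltnP n N.
  have [y yL yx] := (HLn n).2 x sx Px; exists (n :: y); last by case.
  rewrite mem_cat; apply/orP; right; apply/flatten_mapP; exists n; first by rewrite mem_iota.
  exact: map_f.
have [y yL yx] := L0D x sx (ex_intro _ n Px); exists (hd y :: y).
  by rewrite mem_cat map_f.
by case=> [|i] //=; apply: leq_trans Nn; rewrite (leq_bigmax_seq _ yL).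
Qed.

Variables (p q : nat) (a : 'I_p -> nat) (b : 'I_q -> nat).

Definition decode (x : seq nat) : unknowns p q :=
  ([ffun i : 'I_p => nth 0%N x i], [ffun j : 'I_q => nth 0%N x (p + j)],
   nth 0%N x (p + q), nth 0%N x (p + q + 1), nth 0%N x (p + q + 2)).

Lemma decode_surj s : exists2 x, size x = (p + q + 3)%N & decode x = s.
Proof.
case: s => [[[[al be] u] v] r].
pose x1 := [seq al i | i <- enum 'I_p]; pose x2 := [seq be j | j <- enum 'I_q].
have s1 : size x1 = p by rewrite size_map size_enum_ord.
have s2 : size x2 = q by rewrite size_map size_enum_ord.
exists (x1 ++ x2 ++ [:: u; v; r]); first by rewrite !size_cat s1 s2 addnA.
have e3 k : nth 0%N (x1 ++ x2 ++ [:: u; v; r]) (p + q + k) = nth 0%N [:: u; v; r] k.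
  rewrite nth_cat s1 ifN; last by rewrite -leqNgt; lia.
  rewrite nth_cat s2 ifN; last by rewrite -leqNgt; lia.
  by congr nth; lia.
rewrite /decode -{1}[(p + q)%N]addn0 !e3 /=; congr (_, _, _, _, _).
  apply/ffunP => i; rewrite ffunE nth_cat s1 ltn_ord (nth_map i) ?size_enum_ord //.
  by rewrite nth_ord_enum.
apply/ffunP => j; rewrite ffunE nth_cat s1 ltnNge leq_addr /= addKn nth_cat s2 ltn_ord.
by rewrite (nth_map j) ?size_enum_ord // nth_ord_enum.
Qed.

(** By linearity, if one solution dominates another, their difference is a solution. So an
    irreducible solution that dominates an irreducible one equals it, and the finite set given by
    [dickson] contains all of them. *)
Lemma finite_irreducible_solutions : exists L : seq (unknowns p q),
  forall s, s \in L <-> irreducible_solution a b s.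
Proof.
have [L [LP LD]] := dickson (p + q + 3) (fun x => irreducible_solution a b (decode x)).
exists [seq decode x | x <- L] => s; split=> [/mapP[x /LP [Px _] ->] //|irr].
have [x sx xs] := decode_surj s; rewrite -xs in irr *.
have [y yL yx] := LD x sx irr; have [[soly y0 _] _] := LP y yL; have [solx x0 Nred] := irr.
have [->|yNx] := boolp.EM (decode x = decode y); first exact: map_f.
case: Nred; exists (decode y), (decode (mkseq (fun i => nth 0 x i - nth 0 y i)%N (p + q + 3))).
have dE i : (i < p + q + 3)%N -> nth 0%N (mkseq (fun i => nth 0 x i - nth 0 y i)%N (p + q + 3)) i = (nth 0 x i - nth 0 y i)%N.
  by move=> ik; rewrite nth_mkseq.
have sE : decode x = decode y + decode (mkseq (fun i => nth 0 x i - nth 0 y i)%N (p + q + 3)).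
  have xE i : (i < p + q + 3)%N -> nth 0%N x i = (nth 0%N y i + nth 0%N (mkseq (fun i => nth 0 x i - nth 0 y i)%N (p + q + 3)) i)%R.
    by move=> ik; rewrite dE //; exact/esym/subnKC/yx.
  rewrite /decode; congr (_, _, _, _, _); try (apply: xE; lia).
  - by apply/ffunP => i; rewrite !ffunE; apply: xE; have := ltn_ord i; lia.
  - by apply/ffunP => i; rewrite !ffunE; apply: xE; have := ltn_ord i; lia.
split=> //; last first.
  by move=> d0; case: yNx; rewrite sE d0 addr0.
move: solx soly; rewrite sE.
move: (decode y) (decode (mkseq _ _)) => [[[[al be] u] v] r] [[[[al' be'] u'] v'] r'] /=.
have -> : (\sum_(i < p) a i * (al + al')%R i = \sum_(i < p) a i * al i + \sum_(i < p) a i * al' i)%N.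
  by rewrite -big_split; apply: eq_bigr => i _; rewrite ffunE mulnDr.
have -> : (\sum_(i < q) b i * (be + be')%R i = \sum_(i < q) b i * be i + \sum_(i < q) b i * be' i)%N.
  by rewrite -big_split; apply: eq_bigr => i _; rewrite ffunE mulnDr.
have nD (m n : nat) : (m + n)%R = (m + n)%N by [].
rewrite !nD => -[e1 e2] [e3 e4]; split.
  by apply: (@addnI (u + r)%N); rewrite -[in LHS]e3 e1 addnACA.
by apply: (@addnI (v + r)%N); rewrite -[in LHS]e4 e2 addnACA.
Qed.

End Dickson.

(** * Generation by transvectants *)

Section Generation.
Variables (K : numFieldType) (V1 V2 : binary_space).
Local Notation X1 := ('I_(dim V1) -> K).
Local Notation X2 := ('I_(dim V2) -> K).
Local Notation palg2 := (palg (@coord2 K (dim V1) (dim V2))).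
Implicit Types z w : X1 * X2 -> K.

Definition invariant z : Prop := forall t v1 v2,
  z (space_act (uni t) v1, space_act (uni t) v2) = z (v1, v2).

(* In Lie algebra terms w is e_1^r z / r!, and e_1^(r+1) z = 0, where e_1 is the
   raising operator acting on V1 only. *)
Definition flow_top r z w : Prop :=
  [/\ palg2 z, invariant z & forall v1 v2, exists q : {poly K},
    [/\ (size q <= r.+1)%N, q`_r = w (v1, v2) & forall t, z (space_act (uni t) v1, v2) = q.[t]]].

Definition flow_degree_lt r z : Prop :=
  [/\ palg2 z, invariant z & forall v1 v2, exists q : {poly K},
    (size q <= r)%N /\ forall t, z (space_act (uni t) v1, v2) = q.[t]].

Lemma flow_topD r z w z' w' : flow_top r z w -> flow_top r z' w' ->
  flow_top r (fun x => z x + z' x) (fun x => w x + w' x).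
Proof.
move=> [Pz Iz Dz] [Pz' Iz' Dz']; split=> [|t v1 v2|v1 v2].
- by apply: subalg_add => //; exact: palg_subalg.
- by rewrite Iz Iz'.
- have [q [sq tq qE]] := Dz v1 v2; have [q' [sq' tq' qE']] := Dz' v1 v2.
  exists (q + q'); split=> [||t]; rewrite ?coefD ?tq ?tq' // ?hornerD ?qE ?qE' //.
  by rewrite (leq_trans (size_polyD _ _)) // geq_max sq.
Qed.

Lemma flow_topZ r c z w : flow_top r z w -> flow_top r (fun x => c * z x) (fun x => c * w x).
Proof.
move=> [Pz Iz Dz]; split=> [|t v1 v2|v1 v2].
- by apply: subalg_scale => //; exact: palg_subalg.
- by rewrite Iz.
- have [q [sq tq qE]] := Dz v1 v2.
  exists (c *: q); split=> [||t]; rewrite ?coefZ ?tq // ?hornerZ ?qE //.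
  exact: leq_trans (size_scale_leq _ _) sq.
Qed.

Lemma flow_topM r s z w z' w' : flow_top r z w -> flow_top s z' w' ->
  flow_top (r + s) (fun x => z x * z' x) (fun x => w x * w' x).
Proof.
move=> [Pz Iz Dz] [Pz' Iz' Dz']; split=> [|t v1 v2|v1 v2].
- by apply: subalg_mul => //; exact: palg_subalg.
- by rewrite Iz Iz'.
- have [q [sq tq qE]] := Dz v1 v2; have [q' [sq' tq' qE']] := Dz' v1 v2.
  exists (q * q'); split=> [||t]; last by rewrite hornerM qE qE'.
    apply: leq_trans (size_polyMleq _ _) _.
    by rewrite -subn1 leq_subLR; apply: leq_trans (leq_add sq sq') _; lia.
  have rs : (r < (r + s).+1)%N by rewrite ltnS leq_addr.
  rewrite coefM (bigD1 (Ordinal rs)) //= addKn tq tq' big1 ?addr0 // => i.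
  rewrite -val_eqE /= => ir; have [ltir|geir] := ltnP i r.
    by rewrite [q'`__]nth_default ?mulr0 // (leq_trans sq'); lia.
  by rewrite [q`__]nth_default ?mul0r // (leq_trans sq); lia.
Qed.

Lemma flow_top0 r z : flow_top r z (fun=> 0) -> flow_degree_lt r z.
Proof.
move=> [Pz Iz Dz]; split=> // v1 v2; have [q [sq tq qE]] := Dz v1 v2.
exists q; split=> //; apply/leq_sizeP => i; rewrite leq_eqVlt => /orP[/eqP <- //|ri].
by rewrite nth_default // (leq_trans sq).
Qed.

Lemma flow_degree_leq r s z : (r <= s)%N -> flow_degree_lt r z -> flow_degree_lt s z.
Proof.
move=> rs [Pz Iz Dz]; split=> // v1 v2; have [q [sq qE]] := Dz v1 v2.
by exists q; split=> //; apply: leq_trans rs.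
Qed.

(** The polynomials in [flow_top] are given point by point; here their coefficients are polynomial
    functions of (v1, v2), and the degree bound is uniform. *)
Lemma uni_expand2 z : palg2 z -> exists N (q : X1 * X2 -> {poly K}),
  [/\ forall x, (size (q x) <= N)%N, forall i, palg2 (fun x => (q x)`_i)
    & forall t v1 v2, z (space_act (uni t) v1, v2) = (q (v1, v2)).[t]].
Proof.
move=> Pz; have := @expands_comp _ false _ _ _ (fun t x => (space_act (uni t) x.1, x.2)) z _ Pz.
case=> [i|M [N [q [/(_ isT) -> S P E]]]]; last first.
  by exists N, q; split=> // t v1 v2; rewrite -E // mul1r.
have gen (j : 'I_(dim V1) + 'I_(dim V2)) : palg2 (coord2 j) by exact: palg_gen.
case: i => j /=; last exact: (expands_gen false (gen (inr j))).
apply: (subalg_space_act (expands_subalg false _)) => [k l|k]; first exact: expands_invmx_uni.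
exact: (expands_gen false (gen (inl k))).
Qed.

Variables (p q : nat) (f : p.-tuple (coord_ring K V1)) (g : q.-tuple (coord_ring K V2)).
Variables (a : 'I_p -> nat) (b : 'I_q -> nat).
Hypothesis hf : forall i : 'I_p, exists d : nat, bihomogeneous d (a i) (tnth f i).
Hypothesis hg : forall j : 'I_q, exists d : nat, bihomogeneous d (b j) (tnth g j).
Hypothesis genf : generates (@Cov K V1) f.
Hypothesis geng : generates (@Cov K V2) g.

Lemma Cov_monom (V : binary_space) (n : nat) (h : n.-tuple (coord_ring K V)) (al : 'I_n -> nat) :
  (forall i, Cov (tnth h i)) -> Cov (monom h al).
Proof.
move=> ch g' v x D; rewrite /monom !rmorph_prod; apply: eq_bigr => i _.
by rewrite /= !rmorphXn /= ch.
Qed.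

(** Each slice of [w] is a top coefficient in one space, where [top_coef_span] applies;
    [tensor_sum_span] recombines the slices into products. *)
Lemma top_span r z w : flow_top r z w ->
  lspan (fun G => exists (al : {ffun 'I_p -> nat}) (be : {ffun 'I_q -> nat}),
    [/\ (r <= order a al)%N, (r <= order b be)%N &
        G = tensor (lead (monom f al)) (lead (monom g be))]) w.
Proof.
move=> [Pz Iz Dz]; have [N [Q [_ PQ QE]]] := uni_expand2 Pz.
have Qtop x : (size (Q x) <= r.+1)%N /\ (Q x)`_r = w x.
  case: x => v1 v2; have [s [ss ts sE]] := Dz v1 v2.
  by rewrite (_ : Q (v1, v2) = s) //; apply: poly_eval_eq => t _; rewrite -QE sE.
have Ew : w = fun x => (Q x)`_r by apply/funext => x; rewrite (Qtop x).2.
have Pw : palg2 w by rewrite Ew.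
have [s ws] := palg_tensor_sum Pw.
set S1 := fun G => exists2 al : {ffun 'I_p -> nat}, (r <= order a al)%N & G = lead (monom f al).
set S2 := fun G => exists2 be : {ffun 'I_q -> nat}, (r <= order b be)%N & G = lead (monom g be).
have H1 y : lspan S1 (fun x => w (x, y)).
  have := @top_coef_span K V1 p f a hf genf (fun x => z (x, y)) (fun x => Q (x, y)) r.
  rewrite Ew; apply=> [|t v|v]; [|exact: QE|exact: (Qtop _).1].
  apply: (@palg_comp _ _ _ _ _ _ _ (fun x : X1 => (x, y))) Pz => -[i|i] /=.
    exact: palg_gen.
  exact: subalg_cst (palg_subalg _) _.
(* By invariance, moving v2 by u_t amounts to moving v1 by u_{-t}: the flow on V2 is [Q] at -t,
   whose coefficient in degree [r] is (-1)^r w. *)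
have H2 x : lspan S2 (fun y => w (x, y)).
  have := @top_coef_span K V2 q g b hg geng (fun y => z (x, y)) (fun y => Q (x, y) \Po (-1 *: 'X)) r.
  have [_ _ CM] := lspan_closed S2.
  move=> H; rewrite (_ : (fun _ => _) = fun y => (-1) ^+ r * (Q (x, y) \Po (-1 *: 'X))`_r).
    apply: CM; apply: H => [|t v|v].
    - apply: (@palg_comp _ _ _ _ _ _ _ (fun y : X2 => (x, y))) Pz => -[i|i] /=.
        exact: subalg_cst (palg_subalg _) _.
      exact: palg_gen.
    - rewrite horner_comp hornerZ hornerX mulN1r -QE -[RHS](Iz t) uniD subrr.
      by rewrite uni0.
    - apply/leq_sizeP => i ri; rewrite coef_comp_scale nth_default ?mulr0 //.
      exact: leq_trans (Qtop _).1 ri.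
  apply/funext => y; rewrite coef_comp_scale mulrA -exprMn mulrNN mulr1 expr1n mul1r.
  by rewrite (Qtop _).2.
have [W] := @tensor_sum_span K X1 X2 (lspan S1) (lspan S2) s (lspan_closed S1) (lspan_closed S2)
  (fun y => eq_ind w (fun w => lspan S1 (fun x => w (x, y))) (H1 y) _ ws)
  (fun x => eq_ind w (fun w => lspan S2 (fun y => w (x, y))) (H2 x) _ ws).
rewrite ws; apply: W; first exact: lspan_closed.
move=> G [p' [q' [Sp Sq ->]]]; have [W'] := lspan_tensor Sp Sq.
apply: W'; first exact: lspan_closed.
move=> G' [p'' [q'' [[al oa ->] [be ob ->] ->]]]; apply: lspan_gen.
by exists al, be.
Qed.

Local Notation T s := (solution_transvectant a b f g s).

Definition lead_transvectant (s : unknowns p q) (x : X1 * X2) : K := lead (T s) (join x.1 x.2).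

Definition index_of (s : unknowns p q) : nat := s.2.

(** Additive, and positive away from 0: the measure that decreases when a reducible solution is
    split. *)
Definition size_of (s : unknowns p q) : nat :=
  (\sum_(i < p) s.1.1.1.1 i + \sum_(j < q) s.1.1.1.2 j + s.1.1.2 + s.1.2 + s.2)%N.

Definition lead_monoms (s : unknowns p q) : X1 * X2 -> K :=
  tensor (lead (monom f s.1.1.1.1)) (lead (monom g s.1.1.1.2)).

Lemma Cov_solution_transvectant s : Cov (T s).
Proof.
case: s => [[[[al be] u] v] r] /=; apply: Cov_transvectant.
  by apply: Cov_inclL; apply: Cov_monom => i; apply: Cov_gen.
by apply: Cov_inclR; apply: Cov_monom => i; apply: Cov_gen.
Qed.

Lemma palg_lead_join (P : coord_ring K (V1 ++ V2)) : palg2 (fun x => lead P (join x.1 x.2)).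
Proof.
have sE := palg_subalg (@coord2 K (dim V1) (dim V2)).
have gen (j : 'I_(dim V1) + 'I_(dim V2)) : palg2 (coord2 j) by exact: palg_gen.
apply: (subalg_meval sE) => i; rewrite -(splitK i); case: split => j /=; last first.
  rewrite (_ : (fun _ => _) = fun=> vec2 1 0 j); first exact: subalg_cst.
  by apply/funext => x; rewrite pair_fun_r.
rewrite (_ : (fun _ => _) = fun x => join x.1 x.2 j); last by apply/funext => x; rewrite pair_fun_l.
move: j; apply: join_cases => j k jk.
  rewrite (_ : (fun _ => _) = coord2 (inl k)); first exact: gen.
  by apply/funext => x; rewrite (join_l _ _ jk).
rewrite (_ : (fun _ => _) = coord2 (inr k)); first exact: gen.
by apply/funext => x; rewrite (join_r _ _ jk).
Qed.

Lemma invariant_lead_join (P : coord_ring K (V1 ++ V2)) : Cov P -> invariant (fun x => lead P (join x.1 x.2)).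
Proof. by move=> cP t v1 v2 /=; rewrite -space_act_join lead_uni. Qed.

Lemma flow_top_solution s : solution a b s -> exists2 kappa : K, kappa != 0 &
  flow_top (index_of s) (lead_transvectant s) (fun x => kappa * lead_monoms s x).
Proof.
case: s => [[[[al be] u] v] r] [Sa Sb].
have [|||k k0 H] := @transvectant_top K V1 V2 (order a al) (order b be) r (monom f al) (monom g be) _
  (fun v => homog_form_monom hf al v) (fun v => homog_form_monom hg be v).
- by apply: Cov_monom => i; apply: Cov_gen.
- by rewrite /order Sa leq_addl.
- by rewrite /order Sb leq_addl.
exists k => //; split; first exact: palg_lead_join.
  by apply: invariant_lead_join; apply: (Cov_solution_transvectant (al, be, u, v, r)).
exact: H.
Qed.

(** * The algebra generated by the transvectants of irreducible solutions *)

Section Algebra.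
Variable L : seq (unknowns p q).
Hypothesis LP : forall s, s \in L <-> irreducible_solution a b s.
Local Notation C := (in_tuple [seq T s | s <- L]).

(** Membership is tested on leading coefficients, as functions of (v1, v2); [lead_inj] later turns
    it into an equality of covariants. *)
Definition generated z : Prop := exists h, forall x, z x = lead (h \mPo C) (join x.1 x.2).

Lemma generated_subalg : subalg generated.
Proof.
split=> [c|F G [h Fh] [h' Gh]|F G [h Fh] [h' Gh]].
- by exists c%:MP => x; rewrite comp_mpolyC /lead mevalC.
- by exists (h + h') => x; rewrite comp_mpolyD /lead mevalD Fh Gh.
- by exists (h * h') => x; rewrite comp_mpolyM /lead mevalM Fh Gh.
Qed.

Lemma solutionD s1 s2 : solution a b s1 -> solution a b s2 ->
  [/\ size_of (s1 + s2) = (size_of s1 + size_of s2)%N, index_of (s1 + s2) = (index_of s1 + index_of s2)%N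
    & forall x, lead_monoms (s1 + s2) x = lead_monoms s1 x * lead_monoms s2 x].
Proof.
case: s1 s2 => [[[[al be] u] v] r] [[[[al' be'] u'] v'] r'] _ _.
have nD (m n : nat) : (m + n)%R = (m + n)%N by [].
have mD (V : binary_space) (n : nat) (h : n.-tuple (coord_ring K V)) (al1 al2 : {ffun 'I_n -> nat}) v0 :
    lead (monom h (al1 + al2)%R) v0 = lead (monom h al1) v0 * lead (monom h al2) v0.
  rewrite !lead_monom -big_split; apply: eq_bigr => i _.
  by rewrite ffunE exprD.
split=> [||x] //; last by rewrite /lead_monoms /tensor /= !mD mulrACA.
rewrite /size_of /= !nD.
have sD n (al1 al2 : {ffun 'I_n -> nat}) : (\sum_(i < n) (al1 + al2)%R i = \sum_(i < n) al1 i + \sum_(i < n) al2 i)%N.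
  by rewrite -big_split; apply: eq_bigr => i _; rewrite ffunE.
by rewrite !sD; move: (\sum_(_ < _) _)%N (\sum_(_ < _) _)%N (\sum_(_ < _) _)%N (\sum_(_ < _) _)%N => *; lia.
Qed.

Lemma size_of_gt0 s : s <> 0 -> (0 < size_of s)%N.
Proof.
case: s => [[[[al be] u] v] r] s0; rewrite lt0n; apply/eqP => e; case: s0.
move: e; rewrite /size_of /= => /eqP; rewrite !addn_eq0 !sum_nat_eq0.
case/andP=> /andP[/andP[/andP[/forallP al0 /forallP be0] /eqP ->] /eqP ->] /eqP ->.
by congr (_, _, _, _, _); apply/ffunP => i; rewrite ffunE; apply/eqP; [apply: al0|apply: be0].
Qed.

(** A summand of [s] may have the same index as [s], so a second induction, on [size_of], runs
    inside the one on [r]. *)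
Lemma solution_generated r : (forall z, flow_degree_lt r z -> generated z) ->
  forall s, solution a b s -> (index_of s <= r)%N -> generated (lead_transvectant s).
Proof.
have sG := generated_subalg.
move=> IHr s; have [n] := ubnP (size_of s); elim: n s => // n IH s sn Ss rs.
have [sL|sL] := boolP (s \in L).
  have /seq_tnthP [i Ti] : T s \in [seq T s | s <- L] by apply: map_f.
  exists 'X_i => x; rewrite comp_mpolyXU -tnth_nth -Ti //.
(* The zero solution is neither irreducible nor reducible; its transvectant has the constant [k] as
   leading coefficient. *)
have [s0|s0] := boolp.EM (s = 0).
  have [k _ [_ _ Dz]] := flow_top_solution Ss; rewrite s0 in Dz *.
  rewrite (_ : lead_transvectant 0 = fun=> k); first exact: subalg_cst.
  apply/funext => -[v1 v2]; have [c [sc tc cE]] := Dz v1 v2.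
  have := cE 0; rewrite uni0 => ->; rewrite horner_coef0 tc.
  rewrite /lead_monoms /tensor !lead_monom !big1 ?mulr1 // => i _; by rewrite ffunE expr0.
have [s1 [s2 [S1 S2 s10 s20 sE]]] : exists s1 s2 : unknowns p q,
    [/\ solution a b s1, solution a b s2, s1 <> 0, s2 <> 0 & s = s1 + s2].
  by apply: boolp.contrapT => nred; move/negP: sL; apply; apply/LP.
have [sz ix mn] := solutionD S1 S2; have g1 := size_of_gt0 s10; have g2 := size_of_gt0 s20.
rewrite -sE in sz ix mn.
have G1 : generated (lead_transvectant s1).
  apply: IH => //; first by move: sn; rewrite sz ltnS; apply: leq_trans; rewrite -addn1 leq_add2l.
  by apply: leq_trans rs; rewrite ix leq_addr.
have G2 : generated (lead_transvectant s2).
  apply: IH => //; first by move: sn; rewrite sz ltnS; apply: leq_trans; rewrite -add1n leq_add2r.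
  by apply: leq_trans rs; rewrite ix leq_addl.
have [k k0 F] := flow_top_solution Ss; have [k1 k10 F1] := flow_top_solution S1.
have [k2 k20 F2] := flow_top_solution S2.
(* The top coefficients are k and k1 k2 times the same product of leading coefficients; [c] makes
   them cancel. *)
pose c := k / (k1 * k2).
have GD : generated (fun x => lead_transvectant s x + (- c) * (lead_transvectant s1 x * lead_transvectant s2 x)).
  apply: IHr; apply: flow_degree_leq rs _; apply: flow_top0.
  have F12 := flow_topM F1 F2; rewrite -ix in F12.
  have := flow_topD F (flow_topZ (- c) F12).
  congr (flow_top _ _ _); apply/funext => x; rewrite mn /c; field; by rewrite k10 k20.
rewrite (_ : lead_transvectant s = fun x => (lead_transvectant s x + (- c) * (lead_transvectant s1 x * lead_transvectant s2 x))
   + c * (lead_transvectant s1 x * lead_transvectant s2 x)).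
  by apply: subalg_add => //; apply: subalg_scale => //; apply: subalg_mul.
by apply/funext => x; rewrite mulNr subrK.
Qed.

Lemma flow_degree_generated r z : flow_degree_lt r z -> generated z.
Proof.
have sG := generated_subalg.
elim: r z => [|r IH] z Dz.
  have [_ _ H] := Dz; rewrite (_ : z = fun=> 0); first exact: subalg_cst.
  apply/funext => -[v1 v2]; have [s [+ sE]] := H v1 v2; rewrite leqn0 size_poly_eq0 => /eqP s0.
  by have := sE 0; rewrite uni0 s0 horner0.
have [w Fz] : exists w, flow_top r z w.
  have [Pz Iz H] := Dz.
  have /boolp.choice [Q HQ] (x : X1 * X2) : exists s : {poly K}, (size s <= r.+1)%N /\
      forall t, z (space_act (uni t) x.1, x.2) = s.[t] by case: x => v1 v2; apply: H.
  exists (fun x => (Q x)`_r); split=> // v1 v2; have [sQ QE] := HQ (v1, v2).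
  by exists (Q (v1, v2)).
(* Being the top coefficient in degree [r] of a generated function is a linear condition on [w], so
   it need only be checked on the products that span. *)
have [z' Gz' Fz'] : exists2 z', generated z' & flow_top r z' w.
  have [W] := top_span Fz.
  apply: (W (fun w => exists2 z', generated z' & flow_top r z' w)).
  - split=> [|F G [z1 G1 F1] [z2 G2 F2]|c F [z1 G1 F1]].
    + exists (fun=> 0); first exact: subalg_cst.
      split=> //; first exact: subalg_cst (palg_subalg _) _.
      by move=> v1 v2; exists 0; split=> [||t]; rewrite ?size_poly0 ?coef0 ?horner0.
    + exists (fun x => z1 x + z2 x); first exact: subalg_add.
      exact: flow_topD.
    + exists (fun x => c * z1 x); first exact: subalg_scale.
      exact: flow_topZ.
  - move=> G [al [be [oa ob ->]]].
    (* The bounds [r <= order] are exactly what makes the slack unknowns u and v, by truncated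
       subtraction, solve the system. *)
    pose s : unknowns p q := (al, be, (order a al - r)%N, (order b be - r)%N, r).
    have Ss : solution a b s by split; rewrite subnK.
    have [k k0 F] := flow_top_solution Ss.
    exists (fun x => k^-1 * lead_transvectant s x).
      by apply: subalg_scale => //; apply: (solution_generated IH).
    have := flow_topZ k^-1 F; congr (flow_top _ _ _); apply/funext => x.
    by rewrite mulrA mulVf // mul1r.
rewrite (_ : z = fun x => (z x + (-1) * z' x) + z' x); last first.
  by apply/funext => x; rewrite mulN1r subrK.
apply: subalg_add => //; apply: IH; apply: flow_top0.
have := flow_topD Fz (flow_topZ (-1) Fz'); congr (flow_top _ _ _); apply/funext => x.
by rewrite mulN1r subrr.
Qed.

End Algebra.

(** Determinant-one matrices move (1, 0) to every x with x0 nonzero; multiplying the difference by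
    the variable x covers the remaining points. *)
Lemma lead_inj (V : binary_space) (P Q : coord_ring K V) : Cov P -> Cov Q -> lead P =1 lead Q -> P = Q.
Proof.
move=> cP cQ PQ; apply/eqP; rewrite -subr_eq0.
have : 'X_(rshift (dim V) 0) * (P - Q) = 0.
  apply: meval_eq0 => y; rewrite mevalM mevalXU mevalB.
  have [->|y0] := eqVneq (y (rshift (dim V) 0)) 0; first by rewrite mul0r.
  pose v j := y (lshift 2 j); pose x : 'I_2 -> K := fun k => y (rshift (dim V) k).
  have -> : y = pair_fun v x.
    by apply/funext => i; rewrite -(splitK i); case: split => j /=; rewrite ?pair_fun_l ?pair_fun_r.
  have x0 : x 0 != 0 by [].
  pose h := mat2 (x 0) 0 (x 1) (x 0)^-1.
  have D : \det h = 1 by rewrite det_mat2; field.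
  have DI : \det (invmx h) = 1 by rewrite det_inv D invr1.
  have -> : v = space_act h (space_act (invmx h) v).
    by rewrite -space_actM // mulmxV ?space_act1 // det1_unit.
  have -> : x = plane_act h (vec2 1 0).
    by rewrite plane_act_mat2 {1}(vec2_eta x) !mulr1 !mulr0 !addr0.
  by rewrite cP // cQ // -/(lead P _) -/(lead Q _) PQ subrr mulr0.
move/eqP; rewrite mulf_eq0 => /orP[/eqP X0|//].
have := congr1 (meval (fun=> 1 : K)) X0.
by rewrite mevalXU meval0 => /eqP; rewrite oner_eq0.
Qed.

Lemma Cov_comp (V : binary_space) n (t : n.-tuple (coord_ring K V)) (h : {mpoly K[n]}) :
  (forall i, Cov (tnth t i)) -> Cov (h \mPo t).
Proof.
move=> ct g' v x D; rewrite !comp_mpoly_meval; apply: meval_eq => i; exact: ct.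
Qed.

Theorem transvectants_generate : exists L : seq (unknowns p q),
  (forall s : unknowns p q, s \in L <-> irreducible_solution a b s) /\
  generates (@Cov K (V1 ++ V2)) (in_tuple [seq T s | s <- L]).
Proof.
have [L LP] := finite_irreducible_solutions a b; exists L; split=> // P.
have cC i : Cov (tnth (in_tuple [seq T s | s <- L]) i).
  have /mapP[s _ ->] := mem_tnth i (in_tuple [seq T s | s <- L]).
  exact: Cov_solution_transvectant.
split=> [cP|[h ->]]; last exact: Cov_comp.
(* The uniform bound [N] on the degree of the flow is where the induction on degree is entered. *)
have [N [Q [SQ _ QE]]] := uni_expand2 (palg_lead_join P).
have [h hE] : generated L (fun x => lead P (join x.1 x.2)).
  apply: (@flow_degree_generated L LP N); split.
  - exact: palg_lead_join.
  - exact: invariant_lead_join.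
  - by move=> v1 v2; exists (Q (v1, v2)); split=> // t; rewrite -QE.
exists h; apply: lead_inj => //; first exact: Cov_comp.
by move=> v; have [v1 [v2 ->]] := join_eta v; apply: (hE (v1, v2)).
Qed.

End Generation.

Theorem theorem5p7 (R : realType) (V1 V2 : binary_space) (p q : nat)
    (f : p.-tuple (coord_ring R[i] V1)) (g : q.-tuple (coord_ring R[i] V2))
    (a : 'I_p -> nat) (b : 'I_q -> nat)
    (hf : forall i : 'I_p, exists d : nat, bihomogeneous d (a i) (tnth f i))
    (hg : forall j : 'I_q, exists d : nat, bihomogeneous d (b j) (tnth g j))
    (genf : generates (@Cov R[i] V1) f) (geng : generates (@Cov R[i] V2) g) :
  exists L : seq (unknowns p q),
    (forall s : unknowns p q, s \in L <-> irreducible_solution a b s) /\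
    generates (@Cov R[i] (V1 ++ V2))
      (in_tuple [seq solution_transvectant a b f g s | s <- L]).
Proof. exact: transvectants_generate hf hg genf geng. Qed.
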